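(* Let $\Lambda$ be an artin algebra and let $\mathcal{C}$ be a functorially finite (full, additive) subcategory of $\mathrm{mod}\,\Lambda$, closed under direct summands and isomorphisms. (a) If $\mathcal{C}$ contains $D\Lambda$, then the following are equivalent. (i) There exists $t\in\mathbb{N}$ such that for any $X\in\mathrm{ind}\,\mathcal{C}$, $\mathrm{rad}^t_{\mathcal{C}}(X,-)=0$. (ii) For any $X\in\mathrm{ind}\,\mathcal{C}$, there exists $t\in\mathbb{N}$ such that $\mathrm{rad}^t_{\mathcal{C}}(X,-)=0$. (iii) Any family of morphisms between indecomposable $\Lambda$-modules in $\mathcal{C}$ is noetherian. (iv) $\mathcal{C}$ is of finite representation type. (v) $\mathrm{rad}^\infty_{\mathcal{C}}=0$. (b) If $\mathcal{C}$ contains $\Lambda$, then the following are equivalent. (i) There exists $t\in\mathbb{N}$ such that for any $X\in\mathrm{ind}\,\mathcal{C}$, $\mathrm{rad}^t_{\mathcal{C}}(-,X)=0$. (ii) For any $X\in\mathrm{ind}\,\mathcal{C}$, there exists $t\in\mathbb{N}$ such that $\mathrm{rad}^t_{\mathcal{C}}(-,X)=0$. (iii) Any family of morphisms between indecomposable $\Lambda$-modules in $\mathcal{C}$ is conoetherian. (iv) $\mathcal{C}$ is of finite representation type. (v) $\mathrm{rad}^\infty_{\mathcal{C}}=0$.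
   Context: $\Lambda$ is an artin $R$-algebra over a commutative artinian ring $R$; $\mathrm{mod}\,\Lambda$ is the category of finitely generated left $\Lambda$-modules; $D=\mathrm{Hom}_R(-,I)$ with $I$ the injective envelope of $R/J_R$, $J_R$ the Jacobson radical of $R$. A left $\mathcal{C}$-approximation of $X\in\mathrm{mod}\,\Lambda$ is a morphism $\alpha:X\to C$ with $C\in\mathcal{C}$ such that every morphism $X\to C'$ with $C'\in\mathcal{C}$ factors through $\alpha$; right $\mathcal{C}$-approximations are dual. $\mathcal{C}$ is functorially finite if every $X\in\mathrm{mod}\,\Lambda$ has both a left and a right $\mathcal{C}$-approximation. $\mathrm{ind}\,\mathcal{C}$ is the full subcategory of indecomposable objects of $\mathcal{C}$; $\mathcal{C}$ is of finite representation type if it has finitely many isomorphism classes of indecomposable objects. $\mathrm{rad}_{\mathcal{C}}(X,Y)=\{h\in\mathrm{Hom}_{\mathcal{C}}(X,Y) : 1_X-gh \text{ is invertible for all } g\in\mathrm{Hom}_{\mathcal{C}}(Y,X)\}$. For $i\ge 1$, $\mathrm{rad}^i_{\mathcal{C}}(X,Y)$ consists of all finite sums of compositions $X=X_0\xrightarrow{h_1}X_1\to\cdots\xrightarrow{h_i}X_i=Y$ with all $X_j\in\mathcal{C}$ and $h_j\in\mathrm{rad}_{\mathcal{C}}(X_{j-1},X_j)$. $\mathrm{rad}^\infty_{\mathcal{C}}=\bigcap_{i\ge1}\mathrm{rad}^i_{\mathcal{C}}$. $\mathrm{rad}^t_{\mathcal{C}}(X,-)=0$ means $\mathrm{rad}^t_{\mathcal{C}}(X,Y)=0$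 for all $Y\in\mathcal{C}$, and similarly for $\mathrm{rad}^t_{\mathcal{C}}(-,X)=0$. A family $\{f_j\}_{j\in J}$ of morphisms in $\mathcal{C}$ is noetherian if for any infinite chain $C_0\xrightarrow{f_{j_1}}C_1\xrightarrow{f_{j_2}}C_2\to\cdots$ of morphisms in the family with $f_{j_i}\cdots f_{j_2}f_{j_1}\ne0$ for all $i$, there is $d\ge1$ such that $f_{j_k}$ is an isomorphism for all $k\ge d$. It is conoetherian if for any infinite chain $\cdots\to C_2\xrightarrow{f_{j_2}}C_1\xrightarrow{f_{j_1}}C_0$ of morphisms in the family with $f_{j_1}f_{j_2}\cdots f_{j_i}\neq0$ for all $i$, there is $d\ge1$ such that $f_{j_k}$ is an isomorphism for all $k\ge d$. *)

(* Defs.v *)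
From HB Require Import structures.
From mathcomp Require Import all_boot all_order all_algebra.
From mathcomp Require boolp.

Set Implicit Arguments.
Unset Strict Implicit.
Unset Printing Implicit Defensive.

Import GRing.Theory.
Local Open Scope ring_scope.

Section Modules.
Variable A : nzRingType.
Implicit Types (X Y Z : lmodType A) (C : lmodType A -> Prop).

Definition fin_gen X : Prop :=
  exists (n : nat) (e : 'I_n -> X), forall x : X,
  exists c : 'I_n -> A, x = \sum_(k < n) c k *: e k.

Definition is_submodule X (N : X -> Prop) : Prop :=
  [/\ N 0, forall x y, N x -> N y -> N (x + y)
    & forall a x, N x -> N (a *: x)].

Definition is_iso X Y (f : {linear X -> Y}) : Prop :=
  exists g : {linear Y -> X}, cancel f g /\ cancel g f.

Definition isomorphic X Y : Prop := exists f : {linear X -> Y}, is_iso f.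

Definition zero_module X : Prop := forall x : X, x = 0.

Definition indecomposable X : Prop :=
  ~ zero_module X /\
  forall Y Z, isomorphic X (Y * Z)%type -> zero_module Y \/ zero_module Z.

Definition injective_module X : Prop :=
  forall Y Z (i : {linear Y -> Z}) (f : {linear Y -> X}),
  injective i -> exists g : {linear Z -> X}, f =1 g \o i.

Definition essential X Y (i : {linear X -> Y}) : Prop :=
  forall N : Y -> Prop, is_submodule N ->
  (forall y, N y -> (exists x, y = i x) -> y = 0) -> forall y, N y -> y = 0.

Definition injective_envelope X Y : Prop :=
  injective_module Y /\
  exists i : {linear X -> Y}, injective i /\ essential i.

(* A full subcategory of A-mod is given by its class C of objects. *)

Definition additive_subcat C : Prop :=
  (forall X, zero_module X -> C X) /\
  (forall X Y, C X -> C Y -> C (X * Y)%type).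

Definition iso_closed C : Prop := forall X Y, isomorphic X Y -> C X -> C Y.

Definition summand_closed C : Prop :=
  forall X Y, C (X * Y)%type -> C X /\ C Y.

Definition left_approx C X Y (f : {linear X -> Y}) : Prop :=
  C Y /\ forall Z, C Z -> forall h : {linear X -> Z},
    exists g : {linear Y -> Z}, h =1 g \o f.

Definition right_approx C Y X (f : {linear Y -> X}) : Prop :=
  C Y /\ forall Z, C Z -> forall h : {linear Z -> X},
    exists g : {linear Z -> Y}, h =1 f \o g.

Definition functorially_finite C : Prop :=
  forall X, fin_gen X ->
  (exists Y (f : {linear X -> Y}), left_approx C f) /\
  (exists Y (f : {linear Y -> X}), right_approx C f).

Definition finite_rep_type C : Prop :=
  exists (n : nat) (M : 'I_n -> lmodType A),
  (forall k, C (M k) /\ indecomposable (M k)) /\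
  forall X, C X -> indecomposable X -> exists k, isomorphic X (M k).

(* C does not occur: the subcategory is full, so for X and Y in C this is
   the radical of C. *)
Definition is_rad X Y (h : {linear X -> Y}) : Prop :=
  forall g : {linear Y -> X}, is_iso (idfun \- (g \o h)).

(* Composites of exactly i radical maps (i >= 1; the value False at i = 0 is
   never used), all intermediate objects lying in C. *)
Fixpoint rad_comp C (i : nat) X Y (h : {linear X -> Y}) : Prop :=
  match i with
  | 0 => False
  | 1 => is_rad h
  | j.+1 => exists Z (f : {linear X -> Z}) (g : {linear Z -> Y}),
      [/\ C Z, rad_comp C j f, is_rad g & h =1 g \o f]
  end.

Definition rad_pow C (i : nat) X Y (h : {linear X -> Y}) : Prop :=
  exists (n : nat) (u : 'I_n -> {linear X -> Y}),
  (forall k, rad_comp C i (u k)) /\ forall x, h x = \sum_(k < n) u k x.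

Definition rad_pow_from0 C (t : nat) X : Prop :=
  forall Y, C Y -> forall h : {linear X -> Y}, rad_pow C t h -> h =1 \0.

Definition rad_pow_to0 C (t : nat) X : Prop :=
  forall Y, C Y -> forall h : {linear Y -> X}, rad_pow C t h -> h =1 \0.

Definition rad_infty C X Y (h : {linear X -> Y}) : Prop :=
  forall i : nat, (1 <= i)%N -> rad_pow C i h.

Definition rad_infty_eq0 C : Prop :=
  forall X Y, C X -> C Y -> forall h : {linear X -> Y},
  rad_infty C h -> h =1 \0.

Record arrow := Arrow {
  dom : lmodType A;
  cod : lmodType A;
  mor : {linear dom -> cod} }.

Fixpoint comp_up (M : nat -> lmodType A)
    (g : forall i, {linear M i -> M i.+1}) (n : nat) : M 0 -> M n :=
  match n with
  | 0 => idfun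
  | m.+1 => g m \o comp_up g m
  end.

Fixpoint comp_down (M : nat -> lmodType A)
    (g : forall i, {linear M i.+1 -> M i}) (n : nat) : M n -> M 0 :=
  match n with
  | 0 => idfun
  | m.+1 => @comp_down M g m \o g m
  end.

Arguments comp_down {M} g n _.

(* The i-th map of a chain, counted from 1, is g i.-1; the k-th map being an
   isomorphism for all k >= d >= 1 thus reads: g k is one for all k >= d. *)
Definition noetherian (J : Type) (f : J -> arrow) : Prop :=
  forall (M : nat -> lmodType A) (g : forall i, {linear M i -> M i.+1})
         (j : nat -> J),
  (forall i, f (j i) = Arrow (g i)) ->
  (forall i, ~ (comp_up g i.+1 =1 \0)) ->
  exists d : nat, forall k, (d <= k)%N -> is_iso (g k).

Definition conoetherian (J : Type) (f : J -> arrow) : Prop :=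
  forall (M : nat -> lmodType A) (g : forall i, {linear M i.+1 -> M i})
         (j : nat -> J),
  (forall i, f (j i) = Arrow (g i)) ->
  (forall i, ~ (comp_down g i.+1 =1 \0)) ->
  exists d : nat, forall k, (d <= k)%N -> is_iso (g k).

Definition family_in_ind C (J : Type) (f : J -> arrow) : Prop :=
  forall j, [/\ C (dom (f j)), indecomposable (dom (f j)),
                C (cod (f j)) & indecomposable (cod (f j))].

End Modules.

Section CommutativeRings.
Variable R : comNzRingType.

Definition artinian : Prop :=
  forall N : nat -> R^o -> Prop,
  (forall i, is_submodule (N i)) ->
  (forall i x, N i.+1 x -> N i x) ->
  exists d : nat, forall k, (d <= k)%N -> forall x, N k x <-> N d x.

Definition maximal_ideal (m : R^o -> Prop) : Prop :=
  [/\ is_submodule m, ~ m 1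
    & forall n : R^o -> Prop, is_submodule n -> ~ n 1 ->
      (forall x, m x -> n x) -> forall x, n x -> m x].

Definition jacobson_radical (x : R^o) : Prop :=
  forall m : R^o -> Prop, maximal_ideal m -> m x.

(* Q is a copy of R / N. *)
Definition quotient_by (N : R^o -> Prop) (Q : lmodType R) : Prop :=
  exists p : {linear R^o -> Q},
  (forall q, exists r, p r = q) /\ (forall r, p r = 0 <-> N r).

End CommutativeRings.

Definition artin_algebra (R : comNzRingType) (L : algType R) : Prop :=
  artinian R /\ fin_gen (L : lmodType R).

(* Hom_R(L, I), for L viewed as a right module over itself, is a left
   L-module for (a *: f) x = f (x * a). *)
Definition artin_dual (R : comNzRingType) (L : algType R) (I : lmodType R) :=
  {linear L -> I}.

Section Dual.
Variables (R : comNzRingType) (L : algType R) (I : lmodType R).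
Implicit Types (f g h : artin_dual L I) (a b : L).

HB.instance Definition _ := boolp.gen_eqMixin (artin_dual L I).
HB.instance Definition _ := boolp.gen_choiceMixin (artin_dual L I).

Lemma dual_ext f g : f =1 g -> f = g.
Proof.
case: f g => f [[af] [sf]] [g [[ag] [sg]]] /= /boolp.funext efg.
rewrite -{}efg in ag sg *.
by rewrite (boolp.Prop_irrelevance af ag) (boolp.Prop_irrelevance sf sg).
Qed.

Definition dual0 : artin_dual L I := \0.
Definition dual_opp f : artin_dual L I := \- f.
Definition dual_add f g : artin_dual L I := f \+ g.

Lemma dual_addA : associative dual_add.
Proof. by move=> f g h; apply: dual_ext => x /=; rewrite addrA. Qed.
Lemma dual_addC : commutative dual_add.
Proof. by move=> f g; apply: dual_ext => x /=; rewrite addrC. Qed.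
Lemma dual_add0 : left_id dual0 dual_add.
Proof. by move=> f; apply: dual_ext => x /=; rewrite add0r. Qed.
Lemma dual_addN : left_inverse dual0 dual_opp dual_add.
Proof. by move=> f; apply: dual_ext => x /=; rewrite addNr. Qed.

HB.instance Definition _ :=
  GRing.isZmodule.Build (artin_dual L I) dual_addA dual_addC dual_add0 dual_addN.

Definition dual_scale_fun a f (x : L) : I := f (x * a).

Lemma dual_scale_linear a f : linear (dual_scale_fun a f).
Proof. by move=> r x y; rewrite /dual_scale_fun mulrDl -scalerAl linearP. Qed.

HB.instance Definition _ a f :=
  GRing.isLinear.Build R L I *:%R (dual_scale_fun a f) (dual_scale_linear a f).

Definition dual_scale a f : artin_dual L I := dual_scale_fun a f.

Lemma dual_scaleA a b f : dual_scale a (dual_scale b f) = dual_scale (a * b) f.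
Proof. by apply: dual_ext => x; rewrite /= /dual_scale_fun /= /dual_scale_fun mulrA. Qed.
Lemma dual_scale1 : left_id 1 dual_scale.
Proof. by move=> f; apply: dual_ext => x; rewrite /= /dual_scale_fun mulr1. Qed.
Lemma dual_scaleDr : right_distributive dual_scale +%R.
Proof. by move=> a f g; apply: dual_ext => x. Qed.
Lemma dual_scaleDl f : {morph dual_scale^~ f : a b / a + b}.
Proof.
by move=> a b; apply: dual_ext => x; rewrite /= /dual_scale_fun mulrDr linearD.
Qed.

HB.instance Definition _ :=
  GRing.Zmodule_isLmodule.Build L (artin_dual L I)
    dual_scaleA dual_scale1 dual_scaleDr dual_scaleDl.

End Dual.

(* Main.v *)
(* The key input is that rad(X,-) and rad(-,X) are finitely generated on C for X
   indecomposable: an almost split map X -> E (or E -> X) in mod L, built from a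
   functional on End(X) that kills the radical but not the identity, is composed
   with an approximation of E in C.

   (iii) => (iv): the image c of 1 under a left approximation L -> A generates, in
   the sense that every element of every object of C is the image of c under some
   map.  Following c along the components of almost split maps gives a finitely
   branching tree meeting all indecomposables of C; were it infinite, Koenig's
   lemma would yield an infinite chain of radical maps with nonzero composites.
   The conoetherian case starts from a right approximation B -> D(L) instead.

   (iv) => (v): for fixed x in X, the submodules {f x | f in rad^i(X,M)} stabilize for the finitely many indecomposables M, so the stable ones are
   generated by their images under radical maps and vanish by Nakayama's lemma.

   (v) => (i): Hom(A,B) has finite length, so rad^t(A,B) = 0 for some t.  A map
   h : X -> Y in rad^t with h x <> 0 would give a nonzero composite
   A -> X -> Y -> B -> D(L). *)

Require Import Defs.
From HB Require Import structures.
From mathcomp Require Import all_boot all_order all_algebra boolp.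
From mathcomp Require classical_sets.

Set Implicit Arguments.
Unset Strict Implicit.
Unset Printing Implicit Defensive.

Import GRing.Theory.
Local Open Scope ring_scope.

(** What is wanted of an almost split map is only that every radical map factors through it, so E
    can be written down explicitly from a functional on End(X), as a pullback on one side and by
    generators and relations on the other. Such functionals exist because I is an injective
    cogenerator over R; the left-hand construction also uses that a finitely generated R-module is
    its own double dual. Both facts come from one computation: the part of I killed by a maximal
    ideal m is one-dimensional over R/m, because it already lies in R/J. The rest of the duality is
    induction along composition series, and these exist because an artinian ring is noetherian.

    Hom groups are not formed as modules. A map is represented by the tuple of its values at
    finitely many generators, so that radical powers become R-submodules of a finite power of the
    target and length arguments apply to them. In the tree argument a path is likewise represented
    by one element, or by one map into D(L), whose nonvanishing witnesses that the composite is
    nonzero. *)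

Section LinearMaps.
Variable A : nzRingType.
Implicit Types X Y Z : lmodType A.

Lemma linear_ext X Y (f g : {linear X -> Y}) : f =1 g -> f = g.
Proof.
case: f g => f [[af] [sf]] [g [[ag] [sg]]] /= /funext efg.
rewrite -{}efg in ag sg *.
by rewrite (Prop_irrelevance af ag) (Prop_irrelevance sf sg).
Qed.

Definition mklin X Y (f : X -> Y) (fL : linear f) : {linear X -> Y} :=
  HB.pack f (GRing.isLinear.Build A X Y *:%R f fL).

Lemma bijective_iso X Y (f : {linear X -> Y}) : bijective f -> is_iso f.
Proof.
case=> g fK gK.
have gL : linear g.
  by move=> a x y; apply: (can_inj fK); rewrite gK linearP !gK.
by exists (mklin gL).
Qed.

Lemma inj_surj_iso X Y (f : {linear X -> Y}) :
  (forall x, f x = 0 -> x = 0) -> (forall y, exists x, f x = y) -> is_iso f.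
Proof.
move=> f0 /choice[g gK]; apply: bijective_iso; exists g => // x.
by apply/eqP; rewrite -subr_eq0; apply/eqP/f0; rewrite linearB /= gK subrr.
Qed.

Lemma is_iso_id X : is_iso (idfun : {linear X -> X}).
Proof. by exists idfun. Qed.

Lemma is_iso_comp X Y Z (f : {linear X -> Y}) (g : {linear Y -> Z}) :
  is_iso f -> is_iso g -> is_iso (g \o f).
Proof.
move=> [f' [fK f'K]] [g' [gK g'K]]; exists (f' \o g').
by split=> x /=; rewrite ?gK ?fK ?f'K ?g'K.
Qed.

Lemma isomorphic_sym X Y : isomorphic X Y -> isomorphic Y X.
Proof. by case=> f [g [fK gK]]; exists g; exists f. Qed.

End LinearMaps.

(** * Submodules, quotients and finite length *)

Section Submodules.
Variables (A : nzRingType) (X : lmodType A).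
Implicit Types (U V N : X -> Prop).

Lemma is_submoduleB U x y : is_submodule U -> U x -> U y -> U (x - y).
Proof.
by case=> _ UD UZ Ux Uy; rewrite -scaleN1r; apply: UD => //; apply: UZ.
Qed.

Lemma is_submodule_sum U (I : Type) (r : seq I) (P : pred I) (F : I -> X) :
  is_submodule U -> (forall i, P i -> U (F i)) -> U (\sum_(i <- r | P i) F i).
Proof. by case=> U0 UD _ UF; elim/big_ind: _. Qed.

Lemma is_submodule0 : is_submodule (fun x : X => x = 0).
Proof.
by split=> // [x y -> ->|a x ->]; rewrite ?addr0 ?scaler0.
Qed.

Lemma is_submoduleI U V :
  is_submodule U -> is_submodule V -> is_submodule (fun x => U x /\ V x).
Proof.
move=> [U0 UD UZ] [V0 VD VZ]; split=> // [x y [? ?] [? ?]|a x [? ?]].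
  by split; [apply: UD|apply: VD].
by split; [apply: UZ|apply: VZ].
Qed.

Definition adjoin U (x v : X) : Prop := exists a, U (v - a *: x).

Lemma is_submodule_adjoin U x : is_submodule U -> is_submodule (adjoin U x).
Proof.
move=> [U0 UD UZ]; split.
- by exists 0; rewrite scale0r subr0.
- move=> v w [a Ua] [b Ub]; exists (a + b).
  by rewrite scalerDl opprD addrACA; apply: UD.
- move=> c v [a Ua]; exists (c * a).
  by rewrite -scalerA -scalerBr; apply: UZ.
Qed.

Lemma sub_adjoin U x v : U v -> adjoin U x v.
Proof. by exists 0; rewrite scale0r subr0. Qed.

Lemma mem_adjoin U x : is_submodule U -> adjoin U x x.
Proof. by case=> U0 _ _; exists 1; rewrite scale1r subrr. Qed.

Lemma adjoin_min U V x :
  is_submodule V -> (forall v, U v -> V v) -> V x ->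
  forall v, adjoin U x v -> V v.
Proof.
move=> [V0 VD VZ] UV Vx v [a /UV Va].
by rewrite -(subrK (a *: x) v); apply: VD => //; apply: VZ.
Qed.

Fixpoint span_over U (s : seq X) : X -> Prop :=
  if s is x :: s' then adjoin (span_over U s') x else U.

Lemma is_submodule_span U s : is_submodule U -> is_submodule (span_over U s).
Proof. by move=> Us; elim: s => //= x s; exact: is_submodule_adjoin. Qed.

Lemma span_over_base U s v : U v -> span_over U s v.
Proof. by move=> Uv; elim: s => //= x s; exact: sub_adjoin. Qed.

Lemma span_over_mem U s x : is_submodule U -> x \in s -> span_over U s x.
Proof.
move=> Us; elim: s => //= y s IHs; rewrite inE => /orP[/eqP ->|/IHs].
  by apply: mem_adjoin; apply: is_submodule_span.
exact: sub_adjoin.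
Qed.

Lemma span_over_min U V s :
  is_submodule V -> (forall v, U v -> V v) -> (forall x, x \in s -> V x) ->
  forall v, span_over U s v -> V v.
Proof.
move=> Vs UV; elim: s => //= x s IHs sV; apply: adjoin_min => //.
  by apply: IHs => y ys; apply: sV; rewrite inE ys orbT.
by apply: sV; rewrite mem_head.
Qed.

Lemma span_over_cat U s t : span_over U (s ++ t) = span_over (span_over U t) s.
Proof. by elim: s => //= x s ->. Qed.

Lemma span_over0P s v :
  span_over (fun x => x = 0) s v <->
  exists c : 'I_(size s) -> A, v = \sum_(i < size s) c i *: s`_i.
Proof.
elim: s v => [|x s IHs] v /=.
  split=> [->|[c ->]]; last by rewrite big_ord0.
  by exists (fun=> 0); rewrite big_ord0.
split=> [[a /IHs[c vE]]|[c ->]].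
  exists (fun i => if unlift ord0 i is Some j then c j else a).
  rewrite big_ord_recl unlift_none /=.
  under eq_bigr => i _ do rewrite liftK.
  by rewrite -vE addrC subrK.
exists (c ord0); apply/IHs; exists (fun i => c (lift ord0 i)).
by rewrite big_ord_recl /= addrC addKr.
Qed.

Definition spanned (s : seq X) := forall x, span_over (fun x => x = 0) s x.

Lemma fin_genP : fin_gen X <-> exists s, spanned s.
Proof.
split=> [[n [e eX]]|[s sX]].
  exists (codom e) => x.
  have [c ->] := eX x.
  have H := is_submodule_span (codom e) is_submodule0.
  apply: is_submodule_sum H _ => i _.
  have [_ _ HZ] := is_submodule_span (codom e) is_submodule0.
  apply: HZ; apply: span_over_mem; [exact: is_submodule0|exact: codom_f].
exists (size s), (fun i => s`_i) => x; exact/span_over0P/sX.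
Qed.

Lemma fin_gen_finType (T : finType) (e : T -> X) :
  (forall x, exists c : T -> A, x = \sum_t c t *: e t) -> fin_gen X.
Proof.
move=> eX; exists #|T|, (e \o enum_val) => x; have [c ->] := eX x.
by exists (c \o enum_val); rewrite (reindex (@enum_val T T)) //;
  apply: onW_bij; exact: enum_val_bij.
Qed.

(* A length-like invariant: a bounded, strictly monotone function on the
   lattice of submodules. *)
Definition finite_length :=
  exists (len : (X -> Prop) -> nat) (b : nat),
  (forall U, (len U <= b)%N) /\
  forall U V, is_submodule U -> is_submodule V -> (forall x, U x -> V x) ->
    (len U <= len V)%N /\ (len V <= len U -> forall x, V x -> U x)%N.

Lemma nat_bounded_max (b : nat) (P : nat -> Prop) :
  (forall n, P n -> (n <= b)%N) -> (exists n, P n) ->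
  exists2 n, P n & forall m, P m -> (m <= n)%N.
Proof.
move=> Pb [n0 Pn0].
have exP : exists n, `[< P n >] by exists n0; apply/asboolP.
have ubP n : `[< P n >] -> (n <= b)%N by move/asboolP/Pb.
case: (ex_maxnP exP ubP) => n /asboolP Pn nmax; exists n => // m Pm.
by apply: nmax; apply/asboolP.
Qed.

Lemma nat_min (P : nat -> Prop) :
  (exists n, P n) -> exists2 n, P n & forall m, P m -> (n <= m)%N.
Proof.
move=> [n0 Pn0].
have exP : exists n, `[< P n >] by exists n0; apply/asboolP.
case: (ex_minnP exP) => n /asboolP Pn nmin; exists n => // m Pm.
by apply: nmin; apply/asboolP.
Qed.

Lemma finite_length_acc (N : nat -> X -> Prop) :
  finite_length -> (forall i, is_submodule (N i)) ->
  (forall i x, N i x -> N i.+1 x) ->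
  exists d, forall k x, (d <= k)%N -> N k x -> N d x.
Proof.
move=> [len [b [lenb lenS]]] Ns Nup.
have Nmono i j x : (i <= j)%N -> N i x -> N j x.
  move=> /subnK <-; elim: (j - i)%N => // m IHm /IHm; exact: Nup.
have [||_ [d ->] dmax] := @nat_bounded_max b (fun n => exists i, n = len (N i)).
- by move=> _ [i ->].
- by exists (len (N 0)), 0%N.
exists d => k x dk; apply: (lenS _ _ (Ns d) (Ns k) _).2.
  by move=> y; apply: Nmono.
by apply: dmax; exists k.
Qed.

Lemma finite_length_dcc (N : nat -> X -> Prop) :
  finite_length -> (forall i, is_submodule (N i)) ->
  (forall i x, N i.+1 x -> N i x) ->
  exists d, forall k x, (d <= k)%N -> N d x -> N k x.
Proof.
move=> [len [b [_ lenS]]] Ns Ndown.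
have Nmono i j x : (i <= j)%N -> N j x -> N i x.
  move=> /subnK <-; elim: (j - i)%N => // m IHm; rewrite addSn => /Ndown; exact: IHm.
have [|_ [d ->] dmin] := @nat_min (fun n => exists i, n = len (N i)).
  by exists (len (N 0)), 0%N.
exists d => k x dk; apply: (lenS _ _ (Ns k) (Ns d) _).2.
  by move=> y; apply: Nmono.
by apply: dmin; exists k.
Qed.

(** Take a finite list in U whose span has maximal [len]: adjoining a further element of U cannot
    enlarge that span. *)
Lemma finite_length_fin_gen U :
  finite_length -> is_submodule U ->
  exists s : seq X, forall x, U x <-> span_over (fun x => x = 0) s x.
Proof.
move=> [len [b [lenb lenS]]] Us.
pose sp s := span_over (fun x : X => x = 0) s.
pose good (s : seq X) := forall x : X, x \in s -> U x.
have spU s : good s -> forall x, sp s x -> U x.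
  by move=> gs; apply: span_over_min => // x ->; case: Us.
have [||_ [s gs ->] smax] :=
    @nat_bounded_max b (fun n => exists2 s, good s & n = len (sp s)).
- by move=> _ [s _ ->].
- by exists (len (sp [::])), [::].
exists s => x; split; last exact: spU.
move=> Ux.
have gxs : good (x :: s) by move=> y; rewrite inE => /orP[/eqP ->|/gs].
have ss t : is_submodule (sp t) by apply: is_submodule_span is_submodule0.
apply: (lenS _ _ (ss s) (ss (x :: s)) _).2.
- by move=> y; apply: sub_adjoin.
- by apply: smax; exists (x :: s).
- exact: mem_adjoin.
Qed.

End Submodules.

Section SubmoduleType.
Variables (A : nzRingType) (X : lmodType A) (U : X -> Prop).
Hypothesis subU : is_submodule U.

Definition sub_pred of is_submodule U : {pred X} := fun x => `[< U x >].

Lemma sub_pred_closed : submod_closed (sub_pred subU).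
Proof.
case: subU => U0 UD UZ; split=> [|a x y]; rewrite ?inE; first exact/asboolP.
move=> /asboolP Ux /asboolP Uy; apply/asboolP; exact: UD (UZ _ _ Ux) Uy.
Qed.

HB.instance Definition _ :=
  GRing.isSubmodClosed.Build A X (sub_pred subU) sub_pred_closed.

Definition submod := {x : X | sub_pred subU x}.

HB.instance Definition _ := SubChoice.on submod.
HB.instance Definition _ := [SubChoice_isSubLmodule of submod by <:].

Definition submod_val : {linear submod -> X} := val.

Lemma submodP (x : submod) : U (submod_val x).
Proof. by case: x => x /= /asboolP. Qed.

Lemma submod_val_inj : injective submod_val.
Proof. exact: val_inj. Qed.

Lemma submod_lift (Y : lmodType A) (f : {linear Y -> X}) : (forall y, U (f y)) ->
  exists g : {linear Y -> submod}, forall y, submod_val (g y) = f y.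
Proof.
move=> Uf.
have H y : sub_pred subU (f y) by apply/asboolP.
have gL : linear (fun y => exist _ (f y) (H y) : submod).
  by move=> a x y; apply: val_inj; rewrite [RHS]linearP /=; exact: linearP.
by exists (mklin gL).
Qed.

Lemma submod_exists x : U x -> exists u : submod, submod_val u = x.
Proof. by move=> /asboolP Ux; exists (exist _ x Ux). Qed.

End SubmoduleType.

Lemma submod_fin_gen (A : nzRingType) (X : lmodType A) (U : X -> Prop)
  (subU : is_submodule U) :
  finite_length X -> fin_gen (submod subU : lmodType A).
Proof.
move=> flX; have [s sU] := finite_length_fin_gen flX subU.
have Us i : U s`_i.
  have [lti|/(nth_default 0) ->] := ltnP i (size s); last by case: subU.
  by apply/sU; apply: span_over_mem; [exact: is_submodule0|exact: mem_nth].
have /choice[e eE] : forall i : 'I_(size s), exists u : submod subU,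
    submod_val _ u = s`_i by move=> i; apply: submod_exists.
exists (size s), e => x.
have /sU/span_over0P[c xE] := submodP x.
exists c; apply: submod_val_inj; rewrite xE [RHS]linear_sum.
by apply: eq_bigr => i _; rewrite -eE [RHS]linearZ.
Qed.

Section QuotientType.
Variables (A : nzRingType) (X : lmodType A) (U : X -> Prop).
Hypothesis subU : is_submodule U.

(* The quotient by U is carried by canonical representatives of the classes. *)
Definition quot_repr of is_submodule U := fun x : X =>
  choose (fun y => `[< U (x - y) >]) x.

Local Notation repr := (quot_repr subU).

Lemma quot_reprP x : U (x - repr x).
Proof.
apply/asboolP; rewrite (@chooseP _ (fun y => `[< U (x - y) >]) x) //.
by apply/asboolP; rewrite subrr; have [U0 _ _] := subU.
Qed.

Lemma quot_reprE x y : U (x - y) -> repr x = repr y.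
Proof.
move=> Uxy; rewrite /quot_repr.
have E : (fun z => `[< U (x - z) >]) =1 (fun z => `[< U (y - z) >]).
  move=> z; apply: asbool_equiv_eq; split=> Uz.
    by rewrite -[y - z](subrKA x) addrC -(opprB x y) ; apply: is_submoduleB.
  by have [_ UD _] := subU; rewrite -[x - z](subrKA y); apply: UD.
rewrite (eq_choose E); apply: choose_id; apply/asboolP => //; last first.
  by rewrite subrr; have [U0 _ _] := subU.
by rewrite -opprB -scaleN1r; have [_ _ UZ] := subU; apply: UZ.
Qed.

Lemma quot_repr_id x : repr (repr x) == repr x.
Proof.
apply/eqP; apply: quot_reprE; rewrite -opprB -scaleN1r.
by have [_ _ UZ] := subU; apply: UZ; exact: quot_reprP.
Qed.

Definition quot := {x : X | repr x == x}.

HB.instance Definition _ := Choice.on quot.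

Definition quot_pi (x : X) : quot := exist _ (repr x) (quot_repr_id x).

Lemma quot_piP x y : quot_pi x = quot_pi y <-> U (x - y).
Proof.
split=> [[exy]|Uxy]; last by apply: val_inj; exact: quot_reprE.
rewrite -(subrKA (repr x)) {2}exy -[repr y - y]opprB.
by apply: is_submoduleB => //; exact: quot_reprP.
Qed.

Lemma quot_pi_val (u : quot) : quot_pi (val u) = u.
Proof. by apply: val_inj => /=; exact/eqP/(valP u). Qed.

Definition quot_add (u v : quot) := quot_pi (val u + val v).
Definition quot_opp (u : quot) := quot_pi (- val u).
Definition quot_scale a (u : quot) := quot_pi (a *: val u).

Lemma quot_piD x y : quot_pi (x + y) = quot_add (quot_pi x) (quot_pi y).
Proof.
apply/quot_piP; rewrite opprD addrACA.
by have [_ UD _] := subU; apply: UD; exact: quot_reprP.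
Qed.

Lemma quot_piZ a x : quot_pi (a *: x) = quot_scale a (quot_pi x).
Proof.
by apply/quot_piP; rewrite -scalerBr; have [_ _ UZ] := subU; apply: UZ; exact: quot_reprP.
Qed.

Lemma quot_piN x : quot_pi (- x) = quot_opp (quot_pi x).
Proof.
apply/quot_piP; rewrite /= -opprD -sub0r.
by apply: is_submoduleB => //; [case: (subU)|exact: quot_reprP].
Qed.

Lemma quot_addA : associative quot_add.
Proof.
move=> u v w; rewrite -(quot_pi_val u) -(quot_pi_val v) -(quot_pi_val w).
by rewrite -!quot_piD addrA.
Qed.
Lemma quot_addC : commutative quot_add.
Proof. by move=> u v; rewrite /quot_add addrC. Qed.
Lemma quot_add0 : left_id (quot_pi 0) quot_add.
Proof. by move=> u; rewrite -(quot_pi_val u) -quot_piD add0r. Qed.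
Lemma quot_addN : left_inverse (quot_pi 0) quot_opp quot_add.
Proof. by move=> u; rewrite -(quot_pi_val u) -quot_piN -quot_piD addNr. Qed.

HB.instance Definition _ :=
  GRing.isZmodule.Build quot quot_addA quot_addC quot_add0 quot_addN.

Lemma quot_scaleA a b (u : quot) :
  quot_scale a (quot_scale b u) = quot_scale (a * b) u.
Proof. by rewrite -(quot_pi_val u) -!quot_piZ scalerA. Qed.
Lemma quot_scale1 : left_id 1 quot_scale.
Proof. by move=> u; rewrite -(quot_pi_val u) -quot_piZ scale1r. Qed.
Lemma quot_scaleDr : right_distributive quot_scale +%R.
Proof.
move=> a u v; rewrite -(quot_pi_val u) -(quot_pi_val v).
rewrite -[quot_pi (val u) + _]/(quot_add _ _) -quot_piD -!quot_piZ scalerDr.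
exact: quot_piD.
Qed.
Lemma quot_scaleDl u : {morph quot_scale^~ u : a b / a + b}.
Proof.
by move=> a b; rewrite -(quot_pi_val u) -!quot_piZ scalerDl quot_piD.
Qed.

HB.instance Definition _ :=
  GRing.Zmodule_isLmodule.Build A quot
    quot_scaleA quot_scale1 quot_scaleDr quot_scaleDl.

Lemma quotient_exists : exists (Y : lmodType A) (p : {linear X -> Y}),
  (forall y, exists x, p x = y) /\ forall x, p x = 0 <-> U x.
Proof.
have piL : linear (quot_pi : X -> quot).
  by move=> a x y; rewrite quot_piD quot_piZ.
exists quot, (mklin piL); split=> [y|x]; first by exists (val y); exact: quot_pi_val.
by rewrite -[U x]/(U x) -{2}(subr0 x); exact: quot_piP.
Qed.

Lemma factor_exists (Y Z : lmodType A) (p : {linear X -> Y}) (f : {linear X -> Z}) :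
  (forall y, exists x, p x = y) -> (forall x, p x = 0 -> f x = 0) ->
  exists g : {linear Y -> Z}, f = g \o p.
Proof.
move=> /choice[s sK] pf.
have fE x y : p x = p y -> f x = f y.
  move=> pxy; apply/eqP; rewrite -subr_eq0 -linearB; apply/eqP/pf.
  by rewrite linearB /= pxy subrr.
have gL : linear (fun y => f (s y)).
  by move=> a x y; rewrite -linearP; apply: fE; rewrite linearP !sK.
by exists (mklin gL); apply: linear_ext => x; apply: fE; rewrite sK.
Qed.

End QuotientType.

(** * Composition series over an artinian ring *)

(** Zorn's lemma in a form with two uses: v = 1 gives maximal ideals, and other v give quotients in
    which every nonzero submodule contains v. *)
Lemma maximal_avoiding (A : nzRingType) (X : lmodType A) (N : X -> Prop) (v : X) :
  is_submodule N -> ~ N v ->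
  exists U : X -> Prop, [/\ is_submodule U, forall x, N x -> U x, ~ U v &
    forall V : X -> Prop, is_submodule V -> (forall x, U x -> V x) -> ~ V v ->
      forall x, V x -> U x].
Proof.
move=> Ns Nv.
(* The union with N makes the empty chain harmless. *)
pose J (B : X -> Prop) := fun x => N x \/ B x.
pose P : classical_sets.set (classical_sets.set X) :=
  fun B => is_submodule (J B) /\ ~ J B v.
have [F FP Ftot|B [[Bs Bv] Bmax]] := @classical_sets.Zorn_bigcup X P.
  have [N0 ND NZ] := Ns.
  split; first split.
  - by left.
  - move=> x y [Nx|[D FD Dx]] [Ny|[E FE Ey]].
    + by left; apply: ND.
    + have [[_ ED _] _] := FP _ FE.
      by have [|Exy] := ED x y (or_introl Nx) (or_intror Ey); [left|right; exists E].
    + have [[_ DD _] _] := FP _ FD.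
      by have [|Dxy] := DD x y (or_intror Dx) (or_introl Ny); [left|right; exists D].
    + have [DE|ED] := Ftot _ _ FD FE.
        have [[_ HD _] _] := FP _ FE.
        by have [|H] := HD x y (or_intror (DE _ Dx)) (or_intror Ey);
          [left|right; exists E].
      have [[_ HD _] _] := FP _ FD.
      by have [|H] := HD x y (or_intror Dx) (or_intror (ED _ Ey));
        [left|right; exists D].
  - move=> a x [Nx|[D FD Dx]]; first by left; apply: NZ.
    have [[_ _ HZ] _] := FP _ FD.
    by have [|H] := HZ a x (or_intror Dx); [left|right; exists D].
  - by case=> // -[D FD Dv]; have [_] := FP _ FD; apply; right.
exists (J B); split=> //; first by move=> x; left.
move=> V Vs BV Vv x Vx; apply: contrapT => nBx.
have JV : J V = V.
  by apply/predeqP => y; split=> [[Ny|]|]; [apply: BV; left| |right].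
apply: (Bmax V); last by rewrite /P JV.
split=> [y By|E]; first by apply: BV; right.
by apply: nBx; right; apply: E.
Qed.

Section Artinian.
Variable R : comNzRingType.
Implicit Types (m K N U : R^o -> Prop).

Lemma exists_maximal N : is_submodule N -> ~ N 1 ->
  exists2 m, maximal_ideal m & forall x, N x -> m x.
Proof.
move=> Ns N1; have [U [Us NU U1 Umax]] := maximal_avoiding Ns N1.
by exists U => //; split=> // n ns n1 Un; apply: Umax.
Qed.

(** R/m is a field: c is an inverse of a modulo m. *)
Lemma maximal_inv m (a : R) : maximal_ideal m -> ~ m a -> exists c, m (1 - c * a).
Proof.
move=> [ms m1 mmax] ma; apply: contrapT => nc.
apply: ma; apply: (mmax (adjoin m a)).
- exact: is_submodule_adjoin.
- by move=> [c mc]; apply: nc; exists c.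
- by move=> x; apply: sub_adjoin.
- exact: mem_adjoin.
Qed.

(* [comp_series U s]: reading s from its last entry on, each entry x generates a
   simple or zero module modulo the submodule generated by U and the later ones. *)
Fixpoint comp_series (M : lmodType R) (U : M -> Prop) (s : seq M) : Prop :=
  if s is x :: s' then
    comp_series U s' /\
    exists2 m, maximal_ideal m & forall a : R, m a -> span_over U s' (a *: x)
  else True.

Lemma comp_series_cat (M : lmodType R) (U : M -> Prop) s t :
  comp_series U (s ++ t) <-> comp_series U t /\ comp_series (span_over U t) s.
Proof.
elim: s => [|x s IHs] /=; first by split=> [|[]].
by rewrite span_over_cat; split=> [[/IHs[? ?] ?]|[? [? ?]]]; do ?split=> //;
   apply/IHs.
Qed.

(** The map r |-> r e carries a composition series of R to one of U + R e over U. Factors may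
    collapse, which is why [comp_series] allows zero ones. *)
Lemma comp_series_map (M : lmodType R) (U : M -> Prop) (e : M) (s : seq R^o) :
  is_submodule U -> comp_series (fun r => r = 0) s ->
  comp_series U [seq (r : R) *: e | r <- s] /\
  forall r, span_over (fun r => r = 0) s r ->
    span_over U [seq (r : R) *: e | r <- s] ((r : R) *: e).
Proof.
move=> Us; elim: s => [|x s IHs] /=.
  by move=> _; split=> // r ->; rewrite scale0r; case: Us.
move=> [/IHs[cs sps] [m mm mx]]; split.
  by split=> //; exists m => // a /mx /sps; rewrite -scalerA.
move=> r [a /sps H]; exists a; move: H.
by rewrite scalerBl -scalerA.
Qed.

Hypothesis artR : artinian R.

Lemma artinian_min (P : (R^o -> Prop) -> Prop) :
  (exists2 N, is_submodule N & P N) ->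
  exists N, [/\ is_submodule N, P N & forall N', is_submodule N' -> P N' ->
    (forall x, N' x -> N x) -> forall x, N x -> N' x].
Proof.
move=> [N0 N0s PN0]; apply: contrapT => nmin.
pose T := {N | is_submodule N /\ P N}.
have next (N : T) : exists N' : T, (forall x, sval N' x -> sval N x) /\
    ~ (forall x, sval N x -> sval N' x).
  case: N => N [Ns PN] /=; apply: contrapT => nN'; apply: nmin.
  exists N; split=> // N' N's PN' N'N; apply: contrapT => nNN'.
  by apply: nN'; exists (exist _ N' (conj N's PN')).
have [f fP] := choice next.
pose N i := sval (iter i f (exist _ N0 (conj N0s PN0))).
have [||d dP] := artR (N := N).
- by move=> i; rewrite /N; case: (iter i f _) => ? [].
- by move=> i x; exact: (fP _).1.
apply: (fP (iter d f (exist _ N0 (conj N0s PN0)))).2 => x.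
by move=> Nx; apply/(dP d.+1 (leqnSn d) x).
Qed.

Let principal (y : R) : R^o -> Prop := fun x => exists a, x = a * y.

Lemma is_submodule_principal (y : R) : is_submodule (principal y).
Proof.
split; first by exists 0; rewrite mul0r.
  by move=> _ _ [a ->] [b ->]; exists (a + b); rewrite mulrDl.
by move=> c _ [a ->]; exists (c * a); exact: mulrA.
Qed.

(* An artinian ring is noetherian.  Let K be the smallest ideal such that R/K has
   a composition series; if K is nonzero then K has a simple quotient. *)
Lemma artinian_comp_series :
  exists s : seq R^o, comp_series (fun r => r = 0) s /\ spanned s.
Proof.
have mulr4CA (p q u v : R) : p * (q * (u * v)) = u * (p * (q * v)).
  by rewrite (mulrCA q u v) (mulrCA p u).
pose good K := exists s : seq R^o, comp_series K s /\ span_over K s 1.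
have [|K [Ks [rs [csK K1]] Kmin]] := @artinian_min good.
  by exists (fun=> True) => //; exists [::].
have [K0 KD KZ] := Ks.
(* If K is not inside m, then K modulo its intersection with m is simple, so that intersection is
   good, against the minimality of K. *)
have Kjac m : maximal_ideal m -> forall x, K x -> m x.
  move=> mm x Kx; have [ms m1 _] := mm.
  apply: contrapT => nmx.
  have := Kmin (fun y => K y /\ m y) (is_submoduleI Ks ms).
  suff: good (fun y => K y /\ m y).
    by move=> g /(_ g (fun y => @proj1 _ _)) /(_ x Kx)[].
  have spx : span_over (fun y => K y /\ m y) [:: x] = K.
    apply/predeqP => y; split.
      by move=> [a [H _]]; rewrite -(subrK (a *: x) y); apply: KD => //; apply: KZ.
    move=> Ky; have [c mc] := maximal_inv mm nmx.
    exists (y * c); split.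
      by apply: is_submoduleB => //; apply: KZ.
    have -> : y - (y * c) *: (x : R^o) = y *: (1 - c * x : R^o).
      by rewrite /GRing.scale /= mulrBr mulr1 mulrA.
    by case: ms => _ _; apply.
  exists (rs ++ [:: x]); split.
    apply/comp_series_cat; split; last by rewrite spx.
    split=> //; exists m => // a ma; split; first exact: KZ.
    by rewrite /GRing.scale /= mulrC; case: ms => _ _; apply.
  by rewrite span_over_cat spx.
suff Kz : K = (fun r => r = 0).
  exists rs; rewrite -Kz; split=> // x.
  have [_ _ H] := is_submodule_span rs Ks.
  by have := H x 1 K1; rewrite Kz /GRing.scale /= mulr1.
apply/predeqP => x; split=> [Kx|-> //]; apply: contrapT => nx0.
(* For K nonzero, a minimal principal ideal (y) with yK nonzero serves to produce a simple quotient
   of K. *)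
pose bad N := exists2 y, N = principal y & exists2 z, K z & y * z <> 0.
have [|_ [_ [y -> [z0 Kz0 yz0]] ymin]] := @artinian_min bad.
  exists (principal 1); first exact: is_submodule_principal.
  by exists 1 => //; exists x => //; rewrite mul1r.
(* Otherwise (y z) is bad too, so y = w y z by minimality; but w z lies in every maximal ideal, so 1
   - w z is a unit killing y. *)
have yKK z z' : K z -> K z' -> y * z * z' = 0.
  move=> Kz Kz'; apply: contrapT => yzz'.
  have [||||w yE] := ymin (principal (y * z)) _ _ _ y.
  - exact: is_submodule_principal.
  - by exists (y * z) => //; exists z'.
  - by move=> _ [a ->]; exists (a * z); rewrite mulrAC mulrA.
  - by exists 1; rewrite mul1r.
  pose u := 1 - w * z.
  have uy : u * y = 0 by rewrite mulrBl mul1r {1}yE mulrA mulrAC subrr.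
  have [[c cE]|n1] := pselect (principal u 1).
    by apply: yz0; rewrite -[y]mul1r cE -mulrA -mulrA [u * _]mulrA uy mul0r mulr0.
  have [m mm um] := exists_maximal (is_submodule_principal u) n1.
  have [[_ mD mZ] m1 _] := mm.
  apply: m1; rewrite -(subrK (w * z) 1); apply: mD.
    by apply: um; exists 1; rewrite mul1r.
  by apply: mZ; apply: Kjac mm _ Kz.
(* K kills yK, so along the series [rs] of R over K some entry r is the first that does not. Then m
   r lies in the span before it, and r y K is a nonzero vector space over R/m. *)
have [r [m [mm [z Kz rz] mr]]] : exists r m, [/\ maximal_ideal m,
    exists2 z, K z & r * (y * z) <> 0 &
    forall a, m a -> forall z, K z -> a * (r * (y * z)) = 0].
  have : exists2 v, span_over K rs v & exists2 z, K z & v * (y * z) <> 0.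
    by exists 1 => //; exists z0; rewrite ?mul1r.
  elim: rs csK {K1} => [_ [v Kv [z Kz]]|r rs IHs /= [cs [m mm mr]]].
    by rewrite [v * _]mulrC => /(_ (yKK _ _ Kz Kv)).
  move=> [v [a vr] [z Kz vz]].
  have [H|nH] := pselect
    (exists2 v, span_over K rs v & exists2 z, K z & v * (y * z) <> 0).
    exact: IHs.
  have nz w t : span_over K rs w -> K t -> w * (y * t) = 0.
    by move=> Hw Kt; apply: contrapT => H; apply: nH; exists w => //; exists t.
  exists r, m; split=> //.
    exists z => // rz; apply: vz.
    have := nz _ _ vr Kz.
    by rewrite mulrBl -mulrA rz mulr0 subr0.
  by move=> b /mr H t Kt; rewrite [LHS]mulrA; exact: nz H Kt.
pose w0 : R^o := r * (y * z).
have [U [Us _ Uw0 Umax]] := @maximal_avoiding _ R^o _ w0 (is_submodule0 _) rz.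
have [U0 UD UZ] := Us.
(* The map t |-> r y t embeds K/K' into R/U, and maximality of U makes the image one-dimensional
   over R/m, spanned by [w0]. So K' is good, yet it misses z. *)
pose K' : R^o -> Prop := fun t => K t /\ U (r * (y * t)).
have K's : is_submodule K'.
  split; first by split=> //; rewrite !mulr0.
    move=> s t [Ks' Us'] [Kt Ut]; split; first exact: KD.
    by rewrite !mulrDr; apply: UD.
  move=> a s [Ks' Us']; split; first exact: KZ.
  have -> : r * (y * (a * s)) = a * (r * (y * s)) by exact: mulr4CA.
  exact: UZ.
have spz : span_over K' [:: z] = K.
  apply/predeqP => t; split.
    by move=> [a [H _]]; rewrite -(subrK (a *: z) t); apply: KD => //; apply: KZ.
  move=> Kt; have [Ut|nUt] := pselect (U (r * (y * t))).
    by exists 0; rewrite scale0r subr0.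
  have [a Ua] : adjoin U (r * (y * t) : R^o) w0.
    apply: contrapT => H; apply: nUt; apply: (Umax _ _ _ H).
    - exact: is_submodule_adjoin.
    - by move=> s; apply: sub_adjoin.
    - exact: mem_adjoin.
  have nma : ~ m a.
    by move=> ma; apply: Uw0; move: Ua; rewrite /GRing.scale /= mr // subr0.
  have [c mc] := maximal_inv mm nma.
  exists c; split; first by apply: is_submoduleB => //; apply: KZ.
  have -> : r * (y * (t - c * z)) = (- c) * (w0 - a * (r * (y * t))).
    have := mr _ mc _ Kt; rewrite mulrBl mul1r => /eqP; rewrite subr_eq0 => /eqP tE.
    rewrite !mulrBr -/w0 {1}tE mulNr mulNr opprK addrC -(mulrA c).
    by congr (- _ + _); exact: mulr4CA.
  exact: UZ.
have gK' : good K'.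
  exists (rs ++ [:: z]); split; last by rewrite span_over_cat spz.
  apply/comp_series_cat; rewrite spz; split=> //.
  split=> //; exists m => // a ma; split; first exact: KZ.
  have -> : r * (y * (a * z)) = 0 by rewrite mulr4CA mr.
  exact: U0.
apply: Uw0.
by have [] := Kmin K' K's gK' (fun t => @proj1 _ _) z Kz.
Qed.

Lemma fin_gen_comp_series (M : lmodType R) : fin_gen M ->
  exists s : seq M, comp_series (fun x => x = 0) s /\ spanned s.
Proof.
move=> /fin_genP[es esM]; have [rs [cs sp]] := artinian_comp_series.
pose s := flatten [seq [seq (r : R) *: e | r <- rs] | e <- es].
suff [css sps] : comp_series (fun x => x = 0) s /\
    forall x, span_over (fun x => x = 0) es x -> span_over (fun x => x = 0) s x.
  by exists s; split=> // x; apply: sps.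
rewrite /s; elim: es {esM s} => [|e es [cs' sp']] //=.
set s := flatten _ in cs' sp' *.
have ss : is_submodule (span_over (fun x : M => x = 0) s).
  exact/is_submodule_span/is_submodule0.
have [cse spe] := comp_series_map e ss cs.
split; first by apply/comp_series_cat.
have [_ D _] := is_submodule_span [seq (r : R) *: e | r <- rs] ss.
move=> x [a /sp' H]; rewrite span_over_cat -(subrK (a *: e) x); apply: D.
  exact: span_over_base.
by apply: spe; apply: sp.
Qed.

(** The length of U is the number of steps of the series at which the part of U inside the span
    grows. Factors being simple or zero, a larger V growing at the same steps equals U. *)
Lemma comp_series_finite_length (M : lmodType R) (s : seq M) :
  comp_series (fun x => x = 0) s -> spanned s -> finite_length M.
Proof.
move=> css sps.
pose S := span_over (fun x : M => x = 0).
pose jump (x : M) (t : seq M) (U : M -> Prop) :=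
  `[< exists u, [/\ U u, S (x :: t) u & ~ S t u] >].
pose len := fix len (t : seq M) (U : M -> Prop) : nat :=
  if t is x :: t' then (jump x t' U + len t' U)%N else 0%N.
exists (len s), (size s); split.
  move=> U; elim: {css sps} s => //= x t IH.
  by case: (jump x t U); rewrite // add0n; apply: leqW.
move=> U V Us Vs UV; have {sps} : forall x, V x -> S s x by move=> x _; apply: sps.
suff [-> H] : (len s U <= len s V)%N /\ ((len s V <= len s U)%N ->
    forall x, V x -> S s x -> U x).
  by move=> Vsp; split=> // /H{}H x Vx; apply: H => //; apply: Vsp.
elim: s css => [_|x t IHt [/IHt[lenUV UVE] [m mm mx]]] /=.
  by split=> // _ x _ ->; case: Us.
have jUV : (jump x t U <= jump x t V)%N.
  rewrite /jump; case: asboolP => // -[u [Uu ? ?]]; case: asboolP => // -[].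
  by exists u; split=> //; apply: UV.
split; first exact: leq_add.
move=> le; have jE : jump x t U = jump x t V.
  case: (jump x t U) (jump x t V) jUV le => -[] //= _.
  by rewrite add0n add1n ltnNge lenUV.
move: le; rewrite jE leq_add2l => /UVE{}UVE v Vv Sv.
have [Stv|nStv] := pselect (S t v); first exact: UVE.
have : jump x t V by apply/asboolP; exists v.
rewrite -jE => /asboolP[u [Uu [a Sa] nSu]].
have Sts : is_submodule (S t) by apply/is_submodule_span/is_submodule0.
have [_ StD StZ] := Sts.
have nma : ~ m a.
  move=> /mx H; apply: nSu; rewrite -(subrK (a *: x) u); exact: StD.
(* The coefficient a of x in u is invertible modulo m, so a multiple of u cancels the x-part of
   v. *)
have [c mc] := maximal_inv mm nma.
case: Sv => b Sb.
have [_ UD UZ] := Us.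
rewrite -(subrK ((b * c) *: u) v); apply: (UD) (UZ _ _ Uu).
apply: UVE.
  by apply: is_submoduleB => //; apply: UV; apply: UZ.
have -> : v - (b * c) *: u =
    (v - b *: x) - (b * c) *: (u - a *: x) + b *: ((1 - c * a) *: x).
  rewrite !scalerBr scalerBl scale1r scalerBr !scalerA mulrA.
  by rewrite opprD [X in _ = X + _]addrACA -opprD subrK.
apply: StD; last exact/StZ/mx.
by apply: is_submoduleB => //; apply: StZ.
Qed.

Lemma fin_gen_finite_length (M : lmodType R) : fin_gen M -> finite_length M.
Proof.
by move=> /fin_gen_comp_series[s [cs sp]]; apply: comp_series_finite_length cs sp.
Qed.

End Artinian.

(** * Duality into the injective envelope of R/J *)

(** Here f is a bare function, linear on U only; this admits partial maps defined by choice, with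
    arbitrary values off U. *)
Lemma injective_extend (A : nzRingType) (M I : lmodType A) (U : M -> Prop)
  (f : M -> I) :
  injective_module I -> is_submodule U ->
  (forall a x y, U x -> U y -> f (a *: x + y) = a *: f x + f y) ->
  exists g : {linear M -> I}, forall x, U x -> g x = f x.
Proof.
move=> injI subU fL.
have uL : linear (fun u : submod subU => f (submod_val subU u)).
  by move=> a x y; rewrite linearP fL //; exact: submodP.
have [g gE] := injI _ _ (submod_val subU) (mklin uL) (@submod_val_inj _ _ _ subU).
exists g => x /(submod_exists subU)[u <-]; exact/esym/gE.
Qed.

Section Matlis.
Variables (R : comNzRingType) (Q I : lmodType R).
Hypothesis artR : artinian R.
Hypothesis quotQ : quotient_by (@jacobson_radical R) Q.
Hypothesis envI : injective_envelope Q I.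
Implicit Types (m : R^o -> Prop).

Lemma maximal_prime m (a b : R) : maximal_ideal m -> m (a * b) -> ~ m a -> m b.
Proof.
move=> mm mab ma; have [[_ mD mZ] _ _] := mm.
have [c mc] := maximal_inv mm ma.
have -> : b = b * (1 - c * a) + c * (a * b).
  by rewrite mulrBr mulr1 [b * _]mulrC -mulrA subrK.
by apply: mD; apply: mZ.
Qed.

(** A maximal m' omitting r contains m, because m r lies in J and hence in the prime ideal m'. *)
Lemma maximal_annihilator_mod_jacobson m (r : R) :
  maximal_ideal m -> (forall a, m a -> jacobson_radical (a * r : R^o)) ->
  forall m', maximal_ideal m' -> ~ m' r -> m = m'.
Proof.
move=> mm mr m' mm' m'r.
have mm'S x : m x -> m' x.
  move=> mx; have := mr _ mx _ mm'; rewrite mulrC => /maximal_prime; exact.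
have [_ _ mmax] := mm; have [m's m'1 _] := mm'.
by apply/predeqP => x; split=> [/mm'S//|]; apply: mmax.
Qed.

(** R/J contains a copy of R/m. Take (r) minimal among the principal ideals not inside m: a maximal
    m' other than m contains some b outside m, minimality gives (r b) = (r), and so r lies in m'. *)
Lemma exists_maximal_socle m : maximal_ideal m ->
  exists r : R, ~ jacobson_radical (r : R^o) /\
    forall a, m a -> jacobson_radical (a * r : R^o).
Proof.
move=> mm; have [[m0 mD mZ] m1 mmax] := mm.
pose pr (y : R) : R^o -> Prop := fun x => exists a, x = a * y.
have prs y : is_submodule (pr y) by exact: is_submodule_principal.
have [|_ [_ [r -> nmr] rmin]] :=
    @artinian_min R artR (fun N => exists2 y, N = pr y & ~ m y).
  by exists (pr 1) => //; exists 1.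
exists r; split=> [Jr|a ma m' mm'].
  exact: nmr (Jr _ mm).
have [m'a|nm'a] := pselect (m' a).
  by rewrite mulrC; have [[_ _ Z] _ _] := mm'; apply: Z.
have [b m'b nmb] : exists2 b, m' b & ~ m b.
  apply: contrapT => nb; apply: nm'a.
  have [m's m'1 m'max] := mm'.
  have m'm x : m' x -> m x by move=> m'x; apply: contrapT => ?; apply: nb; exists x.
  by apply: (m'max m).
have [||||c rE] := rmin (pr (r * b)) _ _ _ r.
- exact: prs.
- by exists (r * b) => // /(maximal_prime mm) /(_ nmr).
- by move=> _ [c ->]; exists (c * b); rewrite mulrAC mulrA.
- by exists 1; rewrite mul1r.
have [[_ _ Z] _ _] := mm'.
by rewrite rE !mulrA; apply: (Z (_ : R) (b : R^o)).
Qed.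

Lemma socle_nonzero m : maximal_ideal m ->
  exists i : I, i <> 0 /\ forall a, m a -> a *: i = 0.
Proof.
move=> /exists_maximal_socle[r [nJr mr]].
have [p [_ pE]] := quotQ; have [_ [j [j_inj _]]] := envI.
exists (j (p (r : R^o))); split=> [jp0|a ma].
  by apply/nJr/pE/j_inj; rewrite jp0 linear0.
rewrite -!linearZ /=.
by rewrite (pE _).2 ?linear0 //; exact: mr.
Qed.

(** R i is simple and the image of R/J is essential: some nonzero a i lies in the image, and so does
    i, as a is invertible modulo m. *)
Lemma socle_lift m (i : I) : maximal_ideal m -> (forall a, m a -> a *: i = 0) ->
  i <> 0 -> forall (p : {linear R^o -> Q}) (j : {linear Q -> I}),
  (forall q, exists r, p r = q) -> essential j ->
  exists r, i = j (p r).
Proof.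
move=> mm mi i0 p j p_surj ess.
have [a [r [aE ai0]]] : exists a (r : R), a *: i = j (p r) /\ a *: i <> 0.
  apply: contrapT => H.
  pose N (y : I) := exists a : R, y = a *: i.
  apply: i0; apply: (ess N); last by exists 1; rewrite scale1r.
    split; first by exists 0; rewrite scale0r.
      by move=> _ _ [a ->] [b ->]; exists (a + b); rewrite scalerDl.
    by move=> b _ [a ->]; exists (b * a); rewrite scalerA.
  move=> _ [a ->] [q qE]; apply: contrapT => ai0; apply: H.
  by have [r rq] := p_surj q; exists a, r; rewrite rq.
have nma : ~ m a by move/mi.
have [c /mi] := maximal_inv mm nma.
rewrite scalerBl scale1r -scalerA aE => /eqP; rewrite subr_eq0 => /eqP ->.
by exists (c *: (r : R^o)); rewrite !linearZ.
Qed.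

(** The part of I killed by m is one-dimensional over R/m. Nonzero i and i' come from r and s in R
    lying in every maximal ideal other than m; with c an inverse of r modulo m, s - s c r lies in
    all maximal ideals. *)
Lemma socle_cyclic m (i i' : I) : maximal_ideal m ->
  (forall a, m a -> a *: i = 0) -> (forall a, m a -> a *: i' = 0) ->
  i <> 0 -> exists t, i' = t *: i.
Proof.
move=> mm mi mi' i0.
have [i'0|i'0] := pselect (i' = 0); first by exists 0; rewrite scale0r.
have [p [p_surj pE]] := quotQ; have [_ [j [j_inj ess]]] := envI.
have [r rE] := socle_lift mm mi i0 p_surj ess.
have [s sE] := socle_lift mm mi' i'0 p_surj ess.
have ann (t : R) (k : I) : k = j (p (t : R^o)) -> (forall a, m a -> a *: k = 0) ->
    forall a, m a -> jacobson_radical (a * t : R^o).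
  move=> kE mk a /mk; rewrite kE -!linearZ /= => H.
  by apply/pE/j_inj; rewrite linear0.
have Jr := ann r i rE mi; have Js := ann s i' sE mi'.
have nmr : ~ m r.
  move=> mr; apply: i0; rewrite rE.
  rewrite (pE _).2 ?linear0 // => m' mm'; apply: contrapT => nm'r.
  by apply: (nm'r); rewrite -(maximal_annihilator_mod_jacobson mm Jr mm' nm'r).
have [c mc] := maximal_inv mm nmr.
exists (s * c); rewrite rE sE -!linearZ; apply/eqP; rewrite -subr_eq0 -!linearB /=.
rewrite (pE _).2 ?linear0 // => m' mm'; have [ms m'1 _] := mm'.
have mst : m ((s : R^o) - (s * c) *: (r : R^o)).
  have -> : (s : R^o) - (s * c) *: (r : R^o) = s *: (1 - c * r : R^o).
    by rewrite /GRing.scale /= mulrBr mulr1 mulrA.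
  by have [[_ _ Z] _ _] := mm; apply: Z.
have [m'r|nm'r] := pselect (m' r); last first.
  by rewrite -(maximal_annihilator_mod_jacobson mm Jr mm' nm'r).
have [m's|nm's] := pselect (m' s); last first.
  by rewrite -(maximal_annihilator_mod_jacobson mm Js mm' nm's).
by apply: is_submoduleB => //; have [_ _ Z] := ms; apply: Z.
Qed.

(** The annihilator of v modulo N lies in some maximal m, so v may be sent to a nonzero element of I
    killed by m; injectivity extends this from N + R v to M. *)
Lemma functional_separates (M : lmodType R) (N : M -> Prop) (v : M) :
  is_submodule N -> ~ N v ->
  exists f : {linear M -> I}, (forall x, N x -> f x = 0) /\ f v <> 0.
Proof.
move=> Ns Nv; have [N0 ND NZ] := Ns.
pose ann (a : R^o) := N ((a : R) *: v).
have anns : is_submodule ann.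
  rewrite /ann; split=> [|a b|a b]; first by rewrite scale0r.
    by rewrite scalerDl; exact: ND.
  by move=> H; rewrite -scalerA; exact: NZ.
have [|m mm annm] := exists_maximal anns; first by rewrite /ann scale1r.
have [i [i0 mi]] := socle_nonzero mm.
(* The coefficient is chosen arbitrarily: two choices differ by an element of m, which kills i. *)
have /choice[c cP] : forall x, exists c : R, adjoin N v x -> N (x - c *: v).
  by move=> x; have [[c ?]|?] := pselect (adjoin N v x); [exists c|exists 0].
have cE x a : N (x - a *: v) -> c x *: i = a *: i.
  move=> Na; apply/eqP; rewrite -subr_eq0 -scalerBl; apply/eqP/mi/annm.
  rewrite /ann scalerBl; have -> : c x *: v - a *: v = x - a *: v - (x - c x *: v).
    by rewrite opprB [RHS]addrC subrKA.
  by apply: is_submoduleB => //; apply: cP; exists a.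
have [||f fE] := @injective_extend _ M I (adjoin N v) (fun x => c x *: i) envI.1.
- exact: is_submodule_adjoin.
- move=> a x y /cP Nx /cP Ny; rewrite scalerA -scalerDl; apply: cE.
  rewrite scalerDl opprD addrACA -scalerA -scalerBr.
  by apply: ND => //; apply: NZ.
exists f; split=> [x Nx|].
  by rewrite fE ?(@cE x 0) ?scale0r ?subr0 //; exact: sub_adjoin.
rewrite fE; last exact: mem_adjoin.
by rewrite (@cE v 1) ?scale1r // subrr.
Qed.

Lemma functional_eq (M : lmodType R) (x y : M) :
  (forall f : {linear M -> I}, f x = f y) -> x = y.
Proof.
move=> fE; apply: contrapT => nxy.
have [|f [_]] := @functional_separates M _ (x - y) (is_submodule0 M).
  by move/eqP; rewrite subr_eq0 => /eqP.
by rewrite linearB /= fE subrr.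
Qed.

Lemma functional_add (M : lmodType R) (f g : {linear M -> I}) (a : R) :
  exists h : {linear M -> I}, forall x, h x = a *: f x + g x.
Proof.
have hL : linear (fun x => a *: f x + g x).
  by move=> b x y /=; rewrite (linearP f) (linearP g) !scalerDr !scalerA (mulrC a) addrACA.
by exists (mklin hL).
Qed.

(** The induction step along a composition series: evaluation at x sends the functionals vanishing
    on N into the part of I killed by m, which has dimension one. *)
Lemma functional_cyclic (M : lmodType R) (N : M -> Prop) (x : M) m :
  maximal_ideal m -> (forall a, m a -> N (a *: x)) ->
  exists2 f : {linear M -> I}, (forall y, N y -> f y = 0) &
    (forall a, m a -> a *: f x = 0) /\
    forall g : {linear M -> I}, (forall y, N y -> g y = 0) ->
      exists t, g x = t *: f x.
Proof.
move=> mm mx.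
have mg (g : {linear M -> I}) : (forall y, N y -> g y = 0) ->
    forall a, m a -> a *: g x = 0.
  by move=> gN a ma; rewrite -linearZ; apply: gN; apply: mx.
have [[f [fN fx]]|nf] := pselect
    (exists f : {linear M -> I}, (forall y, N y -> f y = 0) /\ f x <> 0).
  exists f => //; split; first exact: mg.
  by move=> g gN; apply: socle_cyclic mm (mg f fN) (mg g gN) fx.
exists \0 => //; split=> [a _|g gN]; first by rewrite scaler0.
exists 0; rewrite scale0r; apply: contrapT => gx; apply: nf; by exists g.
Qed.

(** One functional per step of a composition series is enough: those vanishing on the smaller span
    are multiples of a single one modulo those vanishing on the larger. *)
Lemma dual_fin_gen (M : lmodType R) : fin_gen M ->
  exists n (xi : 'I_n -> {linear M -> I}), forall f : {linear M -> I},
    exists c : 'I_n -> R, forall x, f x = \sum_(k < n) c k *: xi k x.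
Proof.
move=> /(fin_gen_comp_series artR)[s [cs sp]].
suff [n [xi xiP]] : exists n (xi : nat -> {linear M -> I}),
    forall f : {linear M -> I}, exists c : nat -> R, exists2 g : {linear M -> I},
      (forall y, span_over (fun x => x = 0) s y -> g y = 0) &
      forall x, f x = g x + \sum_(k < n) c k *: xi k x.
  exists n, xi => f; have [c [g g0 fE]] := xiP f.
  by exists c => x; rewrite fE g0 ?add0r.
elim: s cs {sp} => [_|x s IHs /= [/IHs[n [xi xiP]] [m mm mx]]].
  exists 0%N, (fun=> \0) => f; exists (fun=> 0), f => [y ->|x]; first exact: linear0.
  by rewrite big_ord0 addr0.
have [f0 f0s [_ f0P]] := functional_cyclic mm mx.
exists n.+1, (fun k => if k == n then f0 else xi k) => f.
have [c [g gs fE]] := xiP f; have [t gx] := f0P g gs.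
have [h hE] := functional_add f0 g (- t).
exists (fun k => if k == n then t else c k), h => [y [a /= ya]|y].
  have -> : h y = a *: h x + h (y - a *: x) by rewrite -(linearP h) addrC subrK.
  by rewrite !hE gx !scaleNr addNr f0s // gs // !scaler0 oppr0 !addr0.
rewrite big_ord_recr /= eqxx hE fE.
under [in RHS]eq_bigr => k _ do rewrite (ltn_eqF (ltn_ord k)).
by rewrite scaleNr [X in _ = _ + X]addrC addrACA addNr add0r.
Qed.

(** Evaluation at x is matched with F on larger and larger sets of functionals, from those vanishing
    on all of M to all of them; each step of the series corrects [x0] by a multiple of x. *)
Lemma reflexive (M : lmodType R) (F : {linear M -> I} -> I) : fin_gen M ->
  (forall (a : R) (f g h : {linear M -> I}),
    (forall x, h x = a *: f x + g x) -> F h = a *: F f + F g) ->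
  exists x : M, forall f, F f = f x.
Proof.
move=> /(fin_gen_comp_series artR)[s [cs sp]] FL.
have F0 (f : {linear M -> I}) : (forall x, f x = 0) -> F f = 0.
  move=> f0; have fE x : f x = 1 *: f x + f x by rewrite !f0 scaler0 addr0.
  have /eqP := FL 1 f f f fE.
  by rewrite scale1r -[X in X == _]add0r (inj_eq (addIr _)) eq_sym => /eqP.
pose perp t (f : {linear M -> I}) := forall y, span_over (fun x => x = 0) t y -> f y = 0.
suff [x xP] : exists x, forall f, perp [::] f -> F f = f x.
  by exists x => f; apply: xP => y ->; exact: linear0.
have : exists x, forall f, perp s f -> F f = f x.
  by exists 0 => f f0; rewrite linear0; apply: F0 => x; apply: f0.
elim: s cs {sp} => // x t IHt /= [/IHt{}IHt [m mm mx]] [x0 x0P]; apply: IHt.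
have [f0 f0t [mf0 f0P]] := functional_cyclic mm mx.
have adj f : perp t f -> f x = 0 -> perp (x :: t) f.
  move=> ft fx y [a /ft]; rewrite linearB linearZ /= fx scaler0 subr0; exact.
have [r rP] : exists r, F f0 - f0 x0 = r *: f0 x.
  have [f0x|f0x] := pselect (f0 x = 0).
    by exists 0; rewrite scale0r x0P ?subrr //; exact: adj.
  (* For a in m, a f0 vanishes at x as well, so F already agrees with [x0] on it; hence m kills F f0
     - f0 x0. *)
  apply: (socle_cyclic mm mf0 _ f0x) => a ma.
  have [h hE] := functional_add f0 (\0 : {linear M -> I}) a.
  have hE' y : h y = a *: f0 y by rewrite hE addr0.
  have := FL a f0 \0 h hE; rewrite [F \0]F0 // addr0 scalerBr => <-.
  rewrite x0P ?hE' ?subrr //; apply: adj; last by rewrite hE' mf0.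
  by move=> y ty; rewrite hE' f0t // scaler0.
exists (x0 + r *: x) => g gt.
have [t' gx] := f0P g gt.
have [h hE] := functional_add f0 g (- t').
have /x0P Fh : perp (x :: t) h.
  apply: adj => [y ty|]; first by rewrite hE f0t // gt // scaler0 addr0.
  by rewrite hE gx scaleNr addNr.
have FgE : F g = h x0 + t' *: F f0.
  by rewrite -Fh (FL _ _ _ _ hE) scaleNr addrAC addNr add0r.
rewrite FgE hE linearD linearZ /= gx scaleNr [- _ + _]addrC -addrA.
by rewrite [- _ + _]addrC -scalerBr rP !scalerA mulrC.
Qed.

End Matlis.

(** * Indecomposable modules and the radical *)

Section Indecomposable.
Variable A : nzRingType.
Implicit Types X Y Z : lmodType A.

Lemma fin_gen_ffun X n : fin_gen X -> fin_gen ({ffun 'I_n -> X} : lmodType A).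
Proof.
move=> [k [e eX]].
pose E (ij : 'I_n * 'I_k) : {ffun 'I_n -> X} :=
  [ffun i => if i == ij.1 then e ij.2 else 0].
apply: (@fin_gen_finType _ _ _ E) => x.
have /choice[c cE] : forall i, exists c : 'I_k -> A, x i = \sum_(j < k) c j *: e j.
  by move=> i; apply: eX.
exists (fun ij => c ij.1 ij.2); apply/ffunP => i.
rewrite sum_ffunE -(pair_bigA _ (fun i' j => (c i' j *: E (i', j)) i)) /=.
rewrite (bigD1 i) //= [X in _ = _ + X]big1 ?addr0 => [|i' ni'].
  by rewrite cE; apply: eq_bigr => j _; rewrite !ffunE /= eqxx.
by rewrite big1 // => j _; rewrite !ffunE /= eq_sym (negPf ni') scaler0.
Qed.

Lemma indecomposable_direct_sum X (U V : X -> Prop) :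
  indecomposable X -> is_submodule U -> is_submodule V ->
  (forall x, U x -> V x -> x = 0) ->
  (forall x, exists u v, [/\ U u, V v & x = u + v]) ->
  (forall x, U x -> x = 0) \/ (forall x, V x -> x = 0).
Proof.
move=> [_ ind] Us Vs UV0 UVT.
have sL : linear (fun p : submod Us * submod Vs => submod_val _ p.1 + submod_val _ p.2).
  move=> a [p1 p2] [q1 q2].
  rewrite -[LHS]/(submod_val Us (a *: p1 + q1) + submod_val Vs (a *: p2 + q2)).
  by rewrite !linearP scalerDr addrACA.
have siso : is_iso (mklin sL).
  apply: inj_surj_iso => [[u v] uv|x].
    have uv0 : submod_val Us u + submod_val Vs v = 0 := uv.
    have u0 : submod_val Us u = 0.
      apply: UV0; first exact: submodP.
      have -> : submod_val Us u = - submod_val Vs v by apply/eqP; rewrite -addr_eq0 uv0.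
      by rewrite -scaleN1r -linearZ; exact: submodP.
    move: uv0; rewrite u0 add0r => v0.
    by congr pair; apply: submod_val_inj; rewrite linear0.
  have [_ [_ [/(submod_exists Us)[u <-] /(submod_exists Vs)[v <-] ->]]] := UVT x.
  by exists (u, v).
have [|U0|V0] := ind (submod Us) (submod Vs).
- by apply: isomorphic_sym; exists (mklin sL).
- by left=> _ /(submod_exists Us)[u <-]; rewrite (U0 u) linear0.
- by right=> _ /(submod_exists Vs)[v <-]; rewrite (V0 v) linear0.
Qed.

Lemma iter_linear X (f : {linear X -> X}) n :
  exists g : {linear X -> X}, g =1 iter n f.
Proof.
elim: n => [|n [g gE]]; first by exists idfun.
by exists (f \o g) => x /=; rewrite gE.
Qed.

Lemma nilpotent_iso X (f : {linear X -> X}) n :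
  (forall x, iter n f x = 0) -> is_iso (idfun \- f).
Proof.
move=> f0; apply: inj_surj_iso => [x /eqP|y] /=.
  rewrite subr_eq0 => /eqP xE; rewrite -(f0 x).
  by elim: n {f0} => //= n <-.
exists (\sum_(i < n) iter i f y); rewrite /= linear_sum -sumrB.
rewrite -[RHS]subr0 -[X in _ - X](f0 y).
elim: n {f0} => [|n IHn]; first by rewrite big_ord0 /= subrr.
by rewrite big_ord_recr /= IHn subrKA.
Qed.

(** For large d, X is the direct sum of the kernel and the image of f^d. If the kernel is zero then
    f is bijective; if the image is zero then f is nilpotent. *)
Lemma fitting X (f : {linear X -> X}) : finite_length X -> indecomposable X ->
  is_iso f \/ is_iso (idfun \- f).
Proof.
move=> flX indX.
have [g gE] := choice (iter_linear f).
pose K n x := iter n f x = 0.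
pose J n x := exists y, x = iter n f y.
have Ks n : is_submodule (K n).
  rewrite /K; split=> [|x y|a x]; rewrite -!gE ?linear0 //.
    by rewrite linearD => -> ->; rewrite addr0.
  by rewrite linearZ /= => ->; rewrite scaler0.
have Js n : is_submodule (J n).
  split; first by exists 0; rewrite -gE linear0.
    by move=> _ _ [x ->] [y ->]; exists (x + y); rewrite -!gE linearD.
  by move=> a _ [x ->]; exists (a *: x); rewrite -!gE linearZ.
have [d1 d1P] := finite_length_acc flX Ks (fun i x (H : iter i f x = 0) =>
  etrans (congr1 f H) (linear0 f)).
have [|d2 d2P] := finite_length_dcc flX Js.
  by move=> i _ [y ->]; exists (f y); rewrite iterSr.
(* A successor, so that injectivity and surjectivity of f^d pass to f. *)
pose d := (maxn d1 d2).+1.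
have d1d : (d1 <= d)%N by rewrite /d ltnW // ltnS leq_maxl.
have d2d : (d2 <= d)%N by rewrite /d ltnW // ltnS leq_maxr.
have KJ x : K d x -> J d x -> x = 0.
  move=> Kx [y xE]; move: Kx; rewrite /K xE -iterD => Ky.
  have /d1P : K (d + d)%N y by [].
  move=> /(_ (leq_trans d1d (leq_addr _ _))) Kd1.
  by rewrite -(subnK d1d) iterD Kd1 -gE linear0.
have KJT x : exists u v, [/\ K d u, J d v & x = u + v].
  have /d2P : J d2 (iter d f x).
    by exists (iter (d - d2) f x); rewrite -iterD subnKC.
  move=> /(_ (d + d)%N (leq_trans d2d (leq_addr _ _)))[y fxE].
  exists (x - iter d f y), (iter d f y); split; last by rewrite subrK.
    by rewrite /K -!gE linearB /= !gE -iterD -fxE subrr.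
  by exists y.
have [K0|J0] := indecomposable_direct_sum indX (Ks d) (Js d) KJ KJT.
  left; apply: inj_surj_iso => [x fx|y].
    by apply: K0; rewrite /K /d iterSr fx -gE linear0.
  have [u [v [/K0 -> [z ->] ->]]] := KJT y.
  by exists (iter (maxn d1 d2) f z); rewrite add0r.
by right; apply: (@nilpotent_iso _ _ d) => x; apply: J0; exists x.
Qed.

Lemma split_mono_iso X Y (h : {linear X -> Y}) (r : {linear Y -> X}) :
  indecomposable Y -> ~ zero_module X -> (forall x, r (h x) = x) -> is_iso h.
Proof.
move=> indY nX rh.
have [|||| H|r0] := @indecomposable_direct_sum Y (fun y => exists x, y = h x)
  (fun y => r y = 0) indY.
- split; first by exists 0; rewrite linear0.
    by move=> _ _ [x ->] [y ->]; exists (x + y); rewrite linearD.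
  by move=> a _ [x ->]; exists (a *: x); rewrite linearZ.
- split=> [|x y|a x]; rewrite ?linear0 ?linearD ?linearZ //=.
    by move=> -> ->; rewrite addr0.
  by move=> ->; rewrite scaler0.
- by move=> _ [x ->]; rewrite rh => ->; rewrite linear0.
- move=> y; exists (h (r y)), (y - h (r y)); split; first by exists (r y).
    by rewrite linearB /= rh subrr.
  by rewrite addrC subrK.
- by case: nX => x; rewrite -(rh x) (H (h x)) ?linear0 //; exists x.
exists r; split=> // y; apply/eqP; rewrite -subr_eq0; apply/eqP/r0.
by rewrite linearB /= rh subrr.
Qed.

(** With w inverse to 1 - v u, the inverse of 1 - u v is 1 + u w v. This makes the one-sided
    definition of the radical symmetric, hence stable under precomposition. *)
Lemma is_iso_jacobson X Y (u : {linear X -> Y}) (v : {linear Y -> X}) :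
  is_iso (idfun \- (v \o u)) -> is_iso (idfun \- (u \o v)).
Proof.
move=> [w [wK Kw]]; exists (idfun \+ (u \o w \o v)).
have wE x : w x = x + w (v (u x)).
  by have := wK x; rewrite /= linearB /= => /eqP; rewrite subr_eq => /eqP.
have Ew x : w x = x + v (u (w x)).
  by have := Kw x; rewrite /= => /eqP; rewrite subr_eq => /eqP.
split=> y /=.
  by rewrite linearB /= linearB /= linearB /= [w (v y)]wE linearD /= addrK subrK.
by rewrite (linearD v) -Ew addrK.
Qed.

Lemma is_rad_compl X Y Z (h : {linear X -> Y}) (b : {linear Y -> Z}) :
  is_rad h -> is_rad (b \o h).
Proof. by move=> rh g; have := rh (g \o b). Qed.

Lemma is_rad_compr X Y Z (a : {linear X -> Y}) (h : {linear Y -> Z}) :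
  is_rad h -> is_rad (h \o a).
Proof. by move=> rh g; apply: (@is_iso_jacobson _ _ (g \o h) a); exact: rh (a \o g). Qed.

(** With w inverse to 1 - g h, one has 1 - g (h + h') = (1 - g h)(1 - w g h'). *)
Lemma is_rad_add X Y (h h' : {linear X -> Y}) :
  is_rad h -> is_rad h' -> is_rad (h \+ h').
Proof.
move=> rh rh' g; have [w [wK Kw]] := rh g.
have /(_ (w \o g)) i2 := rh'.
have := is_iso_comp i2 (rh g).
congr is_iso; apply: linear_ext => x /=.
have /= /eqP := Kw (g (h' x)); rewrite subr_eq => /eqP wE.
rewrite (linearB h) (linearB g) (linearD g) /= {1}wE opprB addrA opprD addrA.
by rewrite subrK opprD addrA addrAC.
Qed.

Lemma is_rad0 X Y : is_rad (\0 : {linear X -> Y}).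
Proof.
move=> g; have := is_iso_id X; congr is_iso; apply: linear_ext => x /=.
by rewrite linear0 subr0.
Qed.

Lemma is_rad_indecomposable_dom X Y (h : {linear X -> Y}) :
  finite_length X -> indecomposable X ->
  (forall g : {linear Y -> X}, ~ is_iso (g \o h)) -> is_rad h.
Proof. by move=> flX indX nh g; have [/nh|//] := fitting (g \o h) flX indX. Qed.

Lemma is_rad_indecomposable_cod X Y (h : {linear X -> Y}) :
  finite_length Y -> indecomposable Y ->
  (forall g : {linear Y -> X}, ~ is_iso (h \o g)) -> is_rad h.
Proof.
move=> flY indY nh g; apply: is_iso_jacobson.
by have [/nh|//] := fitting (h \o g) flY indY.
Qed.

(** If some g h is invertible, h is a split monomorphism into an indecomposable module, hence an
    isomorphism. *)
Lemma is_rad_not_iso X Y (h : {linear X -> Y}) :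
  finite_length X -> indecomposable X -> indecomposable Y -> ~ is_iso h -> is_rad h.
Proof.
move=> flX indX indY nh; apply: is_rad_indecomposable_dom => // g [k [gK _]].
apply: nh; apply: (@split_mono_iso _ _ h (k \o g)) => //.
by case: indX.
Qed.

Lemma is_rad_not_split X Y (h : {linear X -> Y}) (g : {linear Y -> X}) :
  ~ zero_module X -> is_rad h -> ~ (forall x, g (h x) = x).
Proof.
move=> nX /(_ g)[w [wK _]] gh; apply: nX => x.
by rewrite -(wK x) /= gh subrr linear0.
Qed.

Lemma is_rad_nonsplit_iso X Y (h : {linear X -> Y}) :
  ~ zero_module X -> is_rad h -> ~ is_iso h.
Proof. by move=> nX rh [g [hK _]]; exact: is_rad_not_split nX rh hK. Qed.

End Indecomposable.

(** * Powers of the radical of C *)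

Section RadicalPowers.
Variables (A : nzRingType) (C : lmodType A -> Prop).
Implicit Types X Y Z : lmodType A.

Lemma rad_comp_postcomp i X Y Z (h : {linear X -> Y}) (b : {linear Y -> Z}) :
  rad_comp C i h -> rad_comp C i (b \o h).
Proof.
case: i => [//|[|i]] /=; first exact: is_rad_compl.
move=> [W [f [g [CW rf rg hE]]]]; exists W, f, (b \o g); split=> //.
  exact: is_rad_compl.
by move=> x; rewrite /= hE.
Qed.

Lemma rad_comp_precomp i X Y Z (a : {linear X -> Y}) (h : {linear Y -> Z}) :
  rad_comp C i h -> rad_comp C i (h \o a).
Proof.
elim: i Z h => [//|[|i] IHi] Z h; first by move=> /= rh; exact: is_rad_compr.
move=> [W [f [g [CW rf rg hE]]]]; exists W, (f \o a), g; split=> //.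
  exact: IHi.
by move=> x; rewrite /= hE.
Qed.

Lemma rad_comp_rcons i X Y Z (f : {linear X -> Y}) (g : {linear Y -> Z}) :
  C Y -> rad_comp C i f -> is_rad g -> rad_comp C i.+1 (g \o f).
Proof. by case: i => [//|i] CY rf rg; exists Y, f, g. Qed.

Lemma rad_comp_cons i X Y Z (f : {linear X -> Y}) (g : {linear Y -> Z}) :
  C Y -> is_rad f -> rad_comp C i g -> rad_comp C i.+1 (g \o f).
Proof.
move=> CY rf; elim: i Z g => [//|[|i] IHi] Z g.
  by move=> rg; exists Y, f, g.
move=> [W [f' [g' [CW rf' rg' gE]]]]; exists W, (f' \o f), g'; split=> //.
  exact: IHi.
by move=> x; rewrite /= gE.
Qed.

Lemma rad_compW i X Y (h : {linear X -> Y}) :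
  (0 < i)%N -> rad_comp C i.+1 h -> rad_comp C i h.
Proof.
case: i => [//|i] _ [Z [f [g [_ rf _ hE]]]].
have -> : h = g \o f by apply: linear_ext.
exact: rad_comp_postcomp.
Qed.

Lemma rad_comp_pow i X Y (h : {linear X -> Y}) : rad_comp C i h -> rad_pow C i h.
Proof. by move=> rh; exists 1%N, (fun=> h); split=> // x; rewrite big_ord1. Qed.

Lemma rad_powW i X Y (h : {linear X -> Y}) :
  (0 < i)%N -> rad_pow C i.+1 h -> rad_pow C i h.
Proof. by move=> i0 [n [u [ru hE]]]; exists n, u; split=> // k; apply: rad_compW. Qed.

Lemma rad_pow_postcomp i X Y Z (h : {linear X -> Y}) (b : {linear Y -> Z}) :
  rad_pow C i h -> rad_pow C i (b \o h).
Proof.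
move=> [n [u [ru hE]]]; exists n, (fun k => b \o u k); split=> [k|x].
  exact: rad_comp_postcomp.
by rewrite /= hE linear_sum.
Qed.

Lemma rad_pow_precomp i X Y Z (a : {linear X -> Y}) (h : {linear Y -> Z}) :
  rad_pow C i h -> rad_pow C i (h \o a).
Proof.
move=> [n [u [ru hE]]]; exists n, (fun k => u k \o a); split=> [k|x].
  exact: rad_comp_precomp.
by rewrite /= hE.
Qed.

Lemma rad_pow0 i X Y : rad_pow C i (\0 : {linear X -> Y}).
Proof.
by exists 0%N, (fun=> \0); split=> [[]//|x]; rewrite big_ord0.
Qed.

Lemma rad_pow_add i X Y (h h' : {linear X -> Y}) :
  rad_pow C i h -> rad_pow C i h' -> rad_pow C i (h \+ h').
Proof.
move=> [n [u [ru hE]]] [n' [u' [ru' h'E]]].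
exists (n + n')%N, (fun k => match split k with inl j => u j | inr j => u' j end).
split=> [k|x]; first by case: (split k).
rewrite /= hE h'E big_split_ord /=; congr (_ + _); apply: eq_bigr => k _.
  by rewrite -[lshift _ k]/(unsplit (inl k)) unsplitK.
by rewrite -[rshift _ k]/(unsplit (inr k)) unsplitK.
Qed.

(** Splitting off the last factor of each composite supplies the radical maps of the Nakayama
    argument. *)
Lemma rad_powS i X Y (h : {linear X -> Y}) : (0 < i)%N -> rad_pow C i.+1 h ->
  exists n (Z : 'I_n -> lmodType A) (f : forall k, {linear X -> Z k})
    (g : forall k, {linear Z k -> Y}),
  (forall k, [/\ C (Z k), rad_pow C i (f k) & is_rad (g k)]) /\
  forall x, h x = \sum_k g k (f k x).
Proof.
case: i => [//|i] _ [n [u [ru hE]]]; exists n.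
have /choice[Z ZP] : forall k, exists Z,
    exists (fg : {linear X -> Z} * {linear Z -> Y}),
    [/\ C Z, rad_comp C i.+1 fg.1, is_rad fg.2 & u k =1 fg.2 \o fg.1].
  by move=> k; have [Z [f [g H]]] := ru k; exists Z, (f, g).
have [fg fgP] := @fin_all_exists _ _ (fun k (fg : {linear X -> Z k} * {linear Z k -> Y}) =>
    [/\ C (Z k), rad_comp C i.+1 fg.1, is_rad fg.2 & u k =1 fg.2 \o fg.1]) ZP.
exists Z, (fun k => (fg k).1), (fun k => (fg k).2); split=> [k|x].
  by have [? ? ? _] := fgP k; split=> //; exact: rad_comp_pow.
by rewrite hE; apply: eq_bigr => k _; have [_ _ _ ->] := fgP k.
Qed.

End RadicalPowers.

(** * Decomposition into indecomposables *)

Section Decomposition.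
Variable A : nzRingType.
Implicit Types X Y Z : lmodType A.

(** The record carries no equation; [decomposes] imposes the single identity that the composites of
    [proj] and [incl] sum to 1. *)
Record summand Y := Summand {
  part : lmodType A;
  proj : {linear Y -> part};
  incl : {linear part -> Y} }.

Definition decomposes (C : lmodType A -> Prop) Y :=
  exists n (S : 'I_n -> summand Y),
    (forall k, C (part (S k)) /\ indecomposable (part (S k))) /\
    forall y, y = \sum_k incl (S k) (proj (S k) y).

(** Length at most n, said with ascending chains: this explicit bound drops on proper summands and
    is what the decomposition inducts on. *)
Definition chain_bounded n X := forall N : nat -> X -> Prop,
  (forall i, is_submodule (N i)) -> (forall i x, N i x -> N i.+1 x) ->
  exists2 i, (i <= n)%N & forall x, N i.+1 x -> N i x.

Lemma finite_length_chain_bounded X :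
  finite_length X -> exists n, chain_bounded n X.
Proof.
move=> [len [b [lenb lenS]]]; exists b => N Ns Nup; apply: contrapT => H.
suff /(_ b.+1 (leqnn _)) : forall i, (i <= b.+1)%N -> (i <= len (N i))%N.
  by move=> /leq_trans/(_ (lenb _)); rewrite ltnn.
elim=> // i IHi ib; apply: (leq_ltn_trans (IHi (ltnW ib))).
rewrite ltnNge; apply/negP => le; apply: H; exists i => // x.
by apply: (lenS _ _ (Ns i) (Ns i.+1) (Nup i)).2.
Qed.

Lemma chain_bounded_retract n X Y (a : {linear X -> Y}) (b : {linear Y -> X}) :
  chain_bounded n.+1 X -> (forall y, a (b y) = y) -> (exists x, x <> b (a x)) ->
  chain_bounded n Y.
Proof.
move=> bX ab [x0 nx0] N Ns Nup.
(* The chain is carried into X by b up to index n+1 and followed by X itself. That last step is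
   strict because of [x0], so the chain stalls earlier. *)
pose N' i x := (n.+1 < i)%N \/ (N i (a x) /\ x = b (a x)).
have [||i ilen NS] := bX N'.
- move=> i; have [N0 ND NZ] := Ns i; split.
  + by right; rewrite !linear0.
  + move=> x y [?|[Nx xE]]; first by left.
    move=> [?|[Ny yE]]; first by left.
    by right; rewrite !linearD -xE -yE; split=> //; apply: ND.
  + move=> c x [?|[Nx xE]]; first by left.
    by right; rewrite !linearZ /= -xE; split=> //; apply: NZ.
- move=> i x [?|[Nx xE]]; first by left; apply: ltnW.
  by right; split=> //; apply: Nup.
move: ilen; rewrite leq_eqVlt => /orP[/eqP iE|ilen].
  have [||[_ xE]] := NS x0; first by left; rewrite iE.
    by rewrite iE ltnn.
  by case: nx0.
exists i => // y Ny.
have [|lt|[]] := NS (b y); first by right; rewrite !ab.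
  by have := ltn_trans ilen lt; rewrite ltnn.
by rewrite ab.
Qed.

Lemma decomposition (C : lmodType A -> Prop) :
  (forall X, C X -> finite_length X) -> iso_closed C -> summand_closed C ->
  forall Y, C Y -> decomposes C Y.
Proof.
move=> flC isoC sumC Y CY.
have [n] := finite_length_chain_bounded (flC _ CY).
elim: n Y CY => [|n IHn] Y CY bY.
  (* The family is empty and the summand a dummy; the chain from 0 to Y stalls at once, so Y = 0. *)
  exists 0%N, (fun=> Summand (\0 : {linear Y -> Y}) \0); split=> [[]//|y].
  rewrite big_ord0.
  have [||i i0 H] := bY (fun i x => (0 < i)%N \/ x = 0).
  - move=> [|i]; last by split; left.
    split; first by right.
      by move=> u v [//|->] [//|->]; right; rewrite addr0.
    by move=> a x [//|->]; right; rewrite scaler0.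
  - by move=> i x _; left.
  by move: i0 H; rewrite leqn0 => /eqP -> /(_ y (or_introl isT))[].
have [Y0|nY0] := pselect (zero_module Y).
  exists 0%N, (fun=> Summand (\0 : {linear Y -> Y}) \0); split=> [[]//|y].
  by rewrite big_ord0.
have [indY|nindY] := pselect (indecomposable Y).
  exists 1%N, (fun=> Summand (idfun : {linear Y -> Y}) idfun); split=> // y.
  by rewrite big_ord1.
have [Y1 [Y2 [[phi [psi [phiK psiK]]] n1 n2]]] : exists Y1 Y2,
    [/\ isomorphic Y (Y1 * Y2)%type, ~ zero_module Y1 & ~ zero_module Y2].
  apply: contrapT => H; apply: nindY; split=> // Y1 Y2 iY.
  apply: contrapT => nz; apply: H; exists Y1, Y2; split=> // z; apply: nz;
   by [left|right].
have [C1 C2] : C Y1 /\ C Y2 by apply/sumC/(isoC _ _ _ CY); exists phi, psi.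
have p1L : linear (fun y => (phi y).1) by move=> a x y; rewrite linearP.
have p2L : linear (fun y => (phi y).2) by move=> a x y; rewrite linearP.
have q1L : linear (fun y : Y1 => psi (y, 0 : Y2)).
  move=> a x y; rewrite -linearP; congr (psi _).
  by rewrite -[RHS]/(a *: x + y, a *: 0 + 0) scaler0 addr0.
have q2L : linear (fun y : Y2 => psi (0 : Y1, y)).
  move=> a x y; rewrite -linearP; congr (psi _).
  by rewrite -[RHS]/(a *: 0 + 0, a *: x + y) scaler0 addr0.
have [|n1' [S1 [S1P S1E]]] := IHn Y1 C1.
  apply: (chain_bounded_retract (a := mklin p1L) (b := mklin q1L) bY) => /=.
    by move=> y; rewrite psiK.
  apply: contrapT => H; apply: n2 => y2; apply: contrapT => y20; apply: H.
  exists (psi (0, y2)); rewrite psiK => /(can_inj psiK)[y2E].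
  exact: y20.
have [|n2' [S2 [S2P S2E]]] := IHn Y2 C2.
  apply: (chain_bounded_retract (a := mklin p2L) (b := mklin q2L) bY) => /=.
    by move=> y; rewrite psiK.
  apply: contrapT => H; apply: n1 => y1; apply: contrapT => y10; apply: H.
  exists (psi (y1, 0)); rewrite psiK => /(can_inj psiK)[y1E].
  exact: y10.
pose ext Z (p : {linear Y -> Z}) (q : {linear Z -> Y}) (S : summand Z) : summand Y :=
  Summand (proj S \o p) (q \o incl S).
exists (n1' + n2')%N, (fun k => match split k with
  | inl j => ext Y1 (mklin p1L) (mklin q1L) (S1 j)
  | inr j => ext Y2 (mklin p2L) (mklin q2L) (S2 j) end).
split=> [k|y]; first by case: (split k).
rewrite big_split_ord /=.
transitivity (psi ((phi y).1, 0) + psi (0, (phi y).2)).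
  by rewrite -linearD -[_ + _]/((phi y).1 + 0, 0 + (phi y).2) addr0 add0r
    -surjective_pairing phiK.
congr (_ + _).
  rewrite {1}(S1E (phi y).1) -[LHS]/(mklin q1L _) linear_sum.
  by apply: eq_bigr => k _; rewrite -[lshift _ k]/(unsplit (inl k)) unsplitK.
rewrite {1}(S2E (phi y).2) -[LHS]/(mklin q2L _) linear_sum.
by apply: eq_bigr => k _; rewrite -[rshift _ k]/(unsplit (inr k)) unsplitK.
Qed.

End Decomposition.

(** * Finitely generated modules and maps prescribed on generators *)

Section FinGenConstructions.
Variable A : nzRingType.
Implicit Types X Y Z : lmodType A.

Lemma fin_gen_regular : fin_gen (A^o : lmodType A).
Proof. by exists 1%N, (fun=> 1) => x; exists (fun=> x); rewrite big_ord1 /GRing.scale /= mulr1. Qed.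

Lemma fin_gen_surj X Y (p : {linear X -> Y}) :
  (forall y, exists x, p x = y) -> fin_gen X -> fin_gen Y.
Proof.
move=> pS [n [e eX]]; exists n, (p \o e) => y; have [x <-] := pS y.
have [c ->] := eX x; exists c; rewrite linear_sum.
by apply: eq_bigr => k _; rewrite linearZ.
Qed.

Lemma fin_gen_prod X Y : fin_gen X -> fin_gen Y -> fin_gen (X * Y : lmodType A)%type.
Proof.
move=> [n [e eX]] [m [d dY]].
pose E (k : 'I_n + 'I_m) : X * Y :=
  match k with inl i => (e i, 0) | inr j => (0, d j) end.
apply: (@fin_gen_finType _ _ _ E) => -[x y].
have [c xE] := eX x; have [c' yE] := dY y.
exists (fun k => match k with inl i => c i | inr j => c' j end).
rewrite big_sumType /= {1}xE {1}yE.
have fstE T (r : seq T) (F : T -> X * Y) :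
    \sum_(i <- r) F i = (\sum_(i <- r) (F i).1, \sum_(i <- r) (F i).2).
  elim: r => [|i r IHr]; first by rewrite !big_nil.
  by rewrite !big_cons IHr.
rewrite !fstE /=; congr pair.
  by rewrite [X in _ = _ + X]big1 ?addr0 // => j _; rewrite scaler0.
by rewrite [X in _ = X + _]big1 ?add0r // => j _; rewrite scaler0.
Qed.

Lemma free_map Z n (z : 'I_n -> Z) :
  exists f : {linear {ffun 'I_n -> A^o} -> Z}, forall l, f l = \sum_i (l i : A) *: z i.
Proof.
have fL : linear (fun l : {ffun 'I_n -> A^o} => \sum_i (l i : A) *: z i).
  move=> a l l'; rewrite scaler_sumr -big_split /=; apply: eq_bigr => i _.
  by rewrite !ffunE scalerDl scalerA.
by exists (mklin fL).
Qed.

Lemma map_of_relations X Z n (x : 'I_n -> X) (z : 'I_n -> Z) :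
  (forall u, exists c : 'I_n -> A, u = \sum_i c i *: x i) ->
  (forall l : 'I_n -> A, \sum_i l i *: x i = 0 -> \sum_i l i *: z i = 0) ->
  exists f : {linear X -> Z}, forall i, f (x i) = z i.
Proof.
move=> xX rel; have [p pE] := free_map x; have [q qE] := free_map z.
have [||f fE] := @factor_exists _ _ _ _ p q.
- move=> u; have [c ->] := xX u; exists [ffun i => c i]; rewrite pE.
  by apply: eq_bigr => i _; rewrite ffunE.
- by move=> l; rewrite pE qE; exact: rel.
have delta (w : lmodType A) (y : 'I_n -> w) i :
    \sum_j ([ffun j => (j == i)%:R : A^o] j : A) *: y j = y i.
  rewrite (bigD1 i) //= ffunE eqxx scale1r big1 ?addr0 // => j /negPf ji.
  by rewrite ffunE ji scale0r.
by exists f => i; rewrite -(delta _ x i) -pE -(delta _ z i) -qE fE.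
Qed.

Lemma ffun_functional X Z n (F : {linear {ffun 'I_n -> X} -> Z}) :
  exists eta : 'I_n -> {linear X -> Z}, forall y, F y = \sum_i eta i (y i).
Proof.
pose d i (u : X) : {ffun 'I_n -> X} := [ffun j => if j == i then u else 0].
have etaL i : linear (fun u => F (d i u)).
  move=> a u v; rewrite -linearP; congr (F _); apply/ffunP => j.
  by rewrite !ffunE; case: eqP => // _; rewrite scaler0 addr0.
exists (fun i => mklin (etaL i)) => y; rewrite -linear_sum; congr (F _).
apply/ffunP => j; rewrite sum_ffunE (bigD1 j) //= ffunE eqxx big1 ?addr0 // => i.
by rewrite ffunE eq_sym => /negPf ->.
Qed.

(** T x |-> f x is well defined on the image of T, and injectivity extends it to Z. *)
Lemma injective_factor (X Z I : lmodType A) (T : {linear X -> Z})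
  (f : {linear X -> I}) : injective_module I -> (forall x, T x = 0 -> f x = 0) ->
  exists g : {linear Z -> I}, forall x, g (T x) = f x.
Proof.
move=> injI Tf.
have /choice[s sP] : forall z, exists x, (exists x, T x = z) -> T x = z.
  by move=> z; have [[x ?]|nz] := pselect (exists x, T x = z); [exists x|exists 0].
have fE x y : T x = T y -> f x = f y.
  move=> Txy; apply/eqP; rewrite -subr_eq0 -linearB; apply/eqP/Tf.
  by rewrite linearB /= Txy subrr.
have [||g gE] := @injective_extend _ Z I (fun z => exists x, T x = z) (f \o s) injI.
- split; first by exists 0; rewrite linear0.
    by move=> _ _ [x <-] [y <-]; exists (x + y); rewrite linearD.
  by move=> a _ [x <-]; exists (a *: x); rewrite linearZ.
- move=> a x y xT yT; rewrite /= -linearP; apply: fE.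
  have [x' x'E] := xT; have [y' y'E] := yT.
  rewrite linearP !sP //; exists (a *: x' + y').
  by rewrite linearP x'E y'E.
exists g => x; rewrite gE; last by exists x.
by apply: fE; apply: sP; exists x.
Qed.

End FinGenConstructions.

(** * Restriction of scalars from L to R *)

Section RestrictionOfScalars.
Variables (R : comNzRingType) (L : algType R).
Implicit Types X Y Z : lmodType L.

(** An alias convertible to X, so that elements pass freely between the two module structures. *)
Definition restr X : Type := X.

HB.instance Definition _ X := GRing.Zmodule.on (restr X).

Section RestrictedModule.
Variable X : lmodType L.

Definition restr_scale (r : R) (x : restr X) : restr X := (r%:A : L) *: (x : X).

Fact restr_scaleA r s x : restr_scale r (restr_scale s x) = restr_scale (r * s) x.
Proof. by rewrite /restr_scale scalerA mulr_algl scalerA. Qed.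
Fact restr_scale1 : left_id 1 restr_scale.
Proof. by move=> x; rewrite /restr_scale !scale1r. Qed.
Fact restr_scaleDr : right_distributive restr_scale +%R.
Proof. by move=> r x y; exact: scalerDr. Qed.
Fact restr_scaleDl x : {morph restr_scale^~ x : r s / r + s}.
Proof. by move=> r s; rewrite /restr_scale scalerDl; exact: scalerDl. Qed.

HB.instance Definition _ := GRing.Zmodule_isLmodule.Build R (restr X)
  restr_scaleA restr_scale1 restr_scaleDr restr_scaleDl.

End RestrictedModule.

Lemma restr_scaleE X (r : R) (x : X) : r *: (x : restr X) = (r%:A : L) *: x.
Proof. by []. Qed.

Lemma restr_scalel X (r : R) (l : L) (x : X) :
  (r *: l) *: x = r *: (l *: x : restr X).
Proof. by rewrite restr_scaleE scalerA mulr_algl. Qed.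

Lemma restr_scaler X (r : R) (l : L) (x : X) :
  l *: (r *: (x : restr X) : X) = r *: (l *: x : restr X).
Proof. by rewrite -restr_scalel restr_scaleE scalerA mulr_algr. Qed.

Lemma restr_map X Y (f : {linear X -> Y}) :
  exists g : {linear restr X -> restr Y}, forall x, g x = f x.
Proof.
have fL : linear (f : restr X -> restr Y).
  by move=> r x y; rewrite !restr_scaleE; exact: linearP.
by exists (mklin fL).
Qed.

Lemma scale_map X (r : R) :
  exists f : {linear X -> X}, forall x, f x = r *: (x : restr X).
Proof.
have fL : linear (fun x : X => r *: (x : restr X) : X).
  move=> l x y; rewrite [LHS]scalerDr; congr (_ + _); exact/esym/restr_scaler.
by exists (mklin fL).
Qed.

Lemma fin_gen_restr X : fin_gen (L : lmodType R) -> fin_gen X -> fin_gen (restr X : lmodType R).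
Proof.
move=> [n [l lL]] [k [e eX]].
apply: (@fin_gen_finType _ _ _ (fun ij : 'I_n * 'I_k => l ij.1 *: e ij.2 : restr X)) => x.
have [c ->] := eX x; have /choice[d dE] := fun j => lL (c j).
exists (fun ij => d ij.2 ij.1).
rewrite -(pair_bigA _ (fun i j => d j i *: (l i *: e j : restr X))) /= exchange_big /=.
apply: eq_bigr => j _; rewrite {1}(dE j) scaler_suml; apply: eq_bigr => i _.
exact: restr_scalel.
Qed.

Lemma finite_length_restr X : finite_length (restr X : lmodType R) -> finite_length X.
Proof.
move=> [len [b [lenb lenS]]]; exists len, b; split=> // U V [U0 UD UZ] [V0 VD VZ].
by apply: lenS; split=> // r x H; [exact: UZ|exact: VZ].
Qed.

End RestrictionOfScalars.

(** * Almost split maps *)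

Section AlmostSplit.
Variables (R : comNzRingType) (L : algType R) (Q I : lmodType R).
Hypothesis artL : artin_algebra L.
Hypothesis quotQ : quotient_by (@jacobson_radical R) Q.
Hypothesis envI : injective_envelope Q I.
Implicit Types X Y Z : lmodType L.

Lemma fin_gen_restr_finite_length X : fin_gen X -> finite_length (restr X : lmodType R).
Proof.
move=> fgX; apply: fin_gen_finite_length artL.1 _ _.
exact: fin_gen_restr artL.2 fgX.
Qed.

Lemma fin_gen_finite_lengthL X : fin_gen X -> finite_length X.
Proof. by move=> fgX; apply/finite_length_restr/fin_gen_restr_finite_length. Qed.

(* A functional on End(X) vanishing on the radical but not at the identity,
   written on the values of the endomorphisms at generators of X. *)
Lemma radical_functional X n (x : 'I_n -> X) : fin_gen X -> indecomposable X ->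
  (forall u, exists c : 'I_n -> L, u = \sum_i c i *: x i) ->
  exists eta : 'I_n -> {linear restr X -> I},
    (forall f : {linear X -> X}, is_rad f -> \sum_i eta i (f (x i)) = 0) /\
    \sum_i eta i (x i) <> 0.
Proof.
move=> fgX indX xX.
(* In terms of values at the generators, N is the radical of End(X) and v below is the identity. *)
pose N (y : {ffun 'I_n -> restr X}) :=
  exists2 f : {linear X -> X}, is_rad f & forall i, y i = f (x i).
have Ns : is_submodule N.
  split.
  - by exists \0 => [|i]; [exact: is_rad0|rewrite ffunE].
  - move=> y z [f rf yE] [g rg zE]; exists (f \+ g); first exact: is_rad_add.
    by move=> i; rewrite ffunE yE zE.
  - move=> r y [f rf yE]; have [s sE] := scale_map X r.
    exists (s \o f); first exact: is_rad_compl.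
    by move=> i; rewrite ffunE yE /= sE.
pose v : {ffun 'I_n -> restr X} := [ffun i => x i].
have nNv : ~ N v.
  move=> [f rf vE]; apply: (is_rad_not_split (g := idfun) indX.1 rf) => u /=.
  have [c ->] := xX u; rewrite linear_sum; apply: eq_bigr => i _.
  by rewrite linearZ /= -vE ffunE.
have [F [FN Fv]] := functional_separates artL.1 quotQ envI Ns nNv.
have [eta FE] := ffun_functional F.
exists eta; split=> [f rf|].
  have /FN : N [ffun i => f (x i)] by exists f => // i; rewrite ffunE.
  by rewrite FE => F0; rewrite -[RHS]F0; apply: eq_bigr => i _; rewrite ffunE.
by move: Fv; rewrite FE; under eq_bigr do rewrite ffunE.
Qed.

(** One direction of the adjunction between restriction to R and Hom_R(L, -). *)
Lemma functional_to_dual X (xi : {linear restr X -> I}) :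
  exists f : {linear X -> artin_dual L I}, forall x l, f x l = xi (l *: x).
Proof.
have fxL x : linear (fun l : L => xi (l *: x)).
  by move=> r a b; rewrite scalerDl restr_scalel linearP.
have fL : linear (fun x => mklin (fxL x) : artin_dual L I).
  by move=> a x y; apply: dual_ext => l /=; rewrite scalerDr scalerA linearD.
by exists (mklin fL).
Qed.

Lemma artin_dual_sum T (r : seq T) (F : T -> artin_dual L I) l :
  (\sum_(i <- r) F i : artin_dual L I) l = \sum_(i <- r) F i l.
Proof. by elim: r => [|i r IHr]; rewrite ?big_nil // !big_cons -IHr. Qed.

Lemma fin_gen_artin_dual : fin_gen (artin_dual L I : lmodType L).
Proof.
have [n [xi xiP]] := dual_fin_gen artL.1 quotQ envI artL.2.
exists n, xi => f; have [c fE] := xiP f.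
exists (fun k => (c k)%:A); apply: dual_ext => l; rewrite fE artin_dual_sum.
apply: eq_bigr => k _; rewrite -[RHS]/(xi k (l * (c k)%:A)).
by rewrite mulr_algr linearZ.
Qed.

(** Working over R serves left and right L-submodules of L^n alike: relations between generators of
    X form a left one, relations between functionals on X a right one. *)
Lemma ffun_submodule_generators n (U : {ffun 'I_n -> (L : lmodType R)} -> Prop) :
  is_submodule U -> exists m (a : 'I_m -> 'I_n -> L),
    (forall j, U [ffun i => a j i]) /\
    forall l, U l -> exists c : 'I_m -> R, forall i, l i = \sum_j c j *: a j i.
Proof.
move=> Us.
have flL : finite_length ({ffun 'I_n -> (L : lmodType R)} : lmodType R).
  exact/(fin_gen_finite_length artL.1)/fin_gen_ffun/artL.2.
have [s sE] := finite_length_fin_gen flL Us.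
exists (size s), (fun j i => s`_j i); split=> [j|l /sE/span_over0P[c lE]].
  have -> : [ffun i => s`_j i] = s`_j by apply/ffunP => i; rewrite ffunE.
  by apply/sE/span_over_mem; [exact: is_submodule0|exact: mem_nth].
exists c => i; rewrite lE sum_ffunE; apply: eq_bigr => j _; exact: ffunE.
Qed.

(* E is the pullback of X -> D(L)^n, u |-> (l |-> eta i (l u))_i, along the
   transpose D(L)^m -> D(L)^n of the relations a between the generators x of X.
   A map g : Z -> X lifts to E as soon as (z_i) |-> \sum_i eta i (g z_i) kills
   every tuple z_i = k (x i) with k : X -> Z, and there its value is that of the
   radical functional at g k. *)
Lemma right_almost_split X : fin_gen X -> indecomposable X ->
  exists (E : lmodType L) (b : {linear E -> X}), [/\ fin_gen E, is_rad b &
    forall Z (g : {linear Z -> X}), is_rad g -> exists h : {linear Z -> E}, g = b \o h].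
Proof.
move=> fgX indX; have [n [x xX]] := fgX.
have [eta [eta0 eta1]] := radical_functional fgX indX xX.
pose rel (l : {ffun 'I_n -> (L : lmodType R)}) := \sum_i (l i : L) *: x i = 0.
have rels : is_submodule rel.
  rewrite /rel; split.
  - by rewrite big1 // => i _; rewrite ffunE scale0r.
  - move=> l l' lE l'E; under eq_bigr do rewrite ffunE scalerDl.
    by rewrite big_split /= lE l'E addr0.
  - move=> r l lE; transitivity (r *: (\sum_i (l i : L) *: x i : restr X)).
      by rewrite scaler_sumr; apply: eq_bigr => i _; rewrite ffunE restr_scalel.
    by rewrite lE scaler0.
have [m [a [arel aP]]] := ffun_submodule_generators rels.
have a0 j : \sum_i a j i *: x i = 0.
  by rewrite -[RHS](arel j); apply: eq_bigr => i _; rewrite ffunE.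
pose P : lmodType L := (X * {ffun 'I_m -> artin_dual L I})%type.
pose U (p : P) := forall i l, eta i (l *: p.1) = \sum_j p.2 j (a j i * l).
have Us : is_submodule U.
  split.
  - move=> i l; rewrite scaler0 linear0 big1 // => j _.
    by rewrite ffunE.
  - move=> p q Up Uq i l; rewrite scalerDr linearD Up Uq -big_split.
    by apply: eq_bigr => j _; rewrite ffunE.
  - move=> c p Up i l; rewrite scalerA Up; apply: eq_bigr => j _.
    by rewrite ffunE -[RHS]/(p.2 j (a j i * l * c)) mulrA.
have flP : finite_length P.
  apply/fin_gen_finite_lengthL/fin_gen_prod => //.
  exact/fin_gen_ffun/fin_gen_artin_dual.
pose E := submod Us.
have bL : linear (fun u : E => (submod_val Us u).1).
  by move=> c u v; rewrite linearP.
pose b := mklin bL.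
have bE u : b u = (submod_val Us u).1 by [].
exists E, b; split.
- exact: submod_fin_gen.
- apply: is_rad_indecomposable_cod => //; first exact: fin_gen_finite_lengthL.
  (* A section k w of b would express eta i u as \sum_j d_j (a_ji u) at 1; as the a_j are relations
     between the x i, the functional would vanish at the identity. *)
  move=> k [w [wK Kw]]; apply: eta1.
  have dL j : linear (fun u => (submod_val Us (k (w u))).2 j : artin_dual L I).
    by move=> c u v; rewrite !linearP !ffunE.
  pose d j := mklin (dL j).
  have etaE i u : eta i u = \sum_j d j (a j i *: u) 1.
    have := submodP (k (w u)) i 1; rewrite scale1r -bE.
    have -> : b (k (w u)) = u by exact: Kw.
    move=> ->; apply: eq_bigr => j _; rewrite mulr1 linearZ.
    by rewrite -[RHS]/(d j u (1 * a j i)) mul1r.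
  under eq_bigr do rewrite etaE.
  rewrite exchange_big big1 // => j _.
  by rewrite -artin_dual_sum -linear_sum a0 linear0.
move=> Z g rg.
have [g' g'E] := restr_map g.
pose Tf (z : {ffun 'I_n -> restr Z}) : {ffun 'I_m -> restr Z} :=
  [ffun j => \sum_i a j i *: (z i : Z)].
have TL : linear Tf.
  move=> r z z'; apply/ffunP => j; rewrite !ffunE scaler_sumr -big_split.
  by apply: eq_bigr => i _; rewrite !ffunE scalerDr restr_scaler.
have phiL : linear (fun z : {ffun 'I_n -> restr Z} => \sum_i eta i (g' (z i))).
  move=> r z z'; rewrite scaler_sumr -big_split.
  by apply: eq_bigr => i _; rewrite !ffunE !linearP.
have [|psi psiE] := @injective_factor _ _ _ I (mklin TL) (mklin phiL) envI.1.
  move=> z /= Tz; have [l lE|k kE] := @map_of_relations L X Z n x (fun i => z i) xX.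
    have /aP[c lc] : rel [ffun i => l i].
      by rewrite /rel -[RHS]lE; apply: eq_bigr => i _; rewrite ffunE.
    transitivity (\sum_j c j *: (Tf z j)).
      under [RHS]eq_bigr do rewrite ffunE scaler_sumr.
      rewrite exchange_big; apply: eq_bigr => i _.
      have := lc i; rewrite ffunE => ->; rewrite scaler_suml.
      by apply: eq_bigr => j _; rewrite restr_scalel.
    by rewrite Tz big1 // => j _; rewrite ffunE scaler0.
  rewrite -[RHS](eta0 (g \o k)); last exact: is_rad_compr.
  by apply: eq_bigr => i _; rewrite /= kE g'E.
have [zeta zetaE] := ffun_functional psi.
have [D DE] := choice (fun j => functional_to_dual (zeta j)).
have hL : linear (fun z : Z => (g z, [ffun j => D j z]) : P).
  move=> c y z; congr pair; first exact: linearP.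
  by apply/ffunP => j; rewrite !ffunE linearP.
have [|h hE] := submod_lift Us (f := mklin hL); last first.
  by exists h; apply: linear_ext => z; rewrite -[RHS]/(b (h z)) bE hE.
move=> z i l /=.
(* At the tuple with the single entry l z, the identity psi T = phi becomes the equation defining
   E. *)
pose e : {ffun 'I_n -> restr Z} := [ffun i' => if i' == i then l *: z else 0].
have := psiE e; rewrite /= zetaE (bigD1 i) //= [X in _ = _ + X]big1 => [|i' ni'].
  rewrite addr0 !ffunE eqxx g'E -linearZ => <-; apply: eq_bigr => j _.
  rewrite !ffunE DE -scalerA (bigD1 i) //= ffunE eqxx big1 ?addr0 // => i' ni'.
  by rewrite ffunE (negPf ni') scaler0.
by rewrite ffunE (negPf ni') !linear0.
Qed.

End AlmostSplit.

(** * Left almost split maps, by biduality *)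

Section LeftAlmostSplit.
Variables (R : comNzRingType) (L : algType R) (Q I : lmodType R).
Hypothesis artL : artin_algebra L.
Hypothesis quotQ : quotient_by (@jacobson_radical R) Q.
Hypothesis envI : injective_envelope Q I.
Implicit Types X Y Z : lmodType L.

(* phi i is the functional z |-> xi i (k z); as X is its own double dual, k can
   be recovered from the phi i. *)
Lemma map_of_dual_relations X Z n (xi : 'I_n -> {linear restr X -> I})
  (phi : 'I_n -> {linear restr Z -> I}) : fin_gen X ->
  (forall f : {linear restr X -> I}, exists c : 'I_n -> R,
    forall x, f x = \sum_i c i *: xi i x) ->
  (forall l : 'I_n -> L, (forall x : X, \sum_i xi i (l i *: x) = 0) ->
    forall z : Z, \sum_i phi i (l i *: z) = 0) ->
  exists k : {linear Z -> X}, forall i z, xi i (k z) = phi i z.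
Proof.
move=> fgX xiX rel; have [co coP] := choice xiX.
(* R-linear relations are a case of [rel], so the value \sum_i c_i phi_i z depends on the functional
   \sum_i c_i xi_i alone and not on the coefficients [co] chosen for it. *)
have ev (c d : 'I_n -> R) : (forall x, \sum_i c i *: xi i x = \sum_i d i *: xi i x) ->
    forall z, \sum_i c i *: phi i z = \sum_i d i *: phi i z.
  move=> cd z; apply/eqP; rewrite -subr_eq0 -sumrB; apply/eqP.
  rewrite -[RHS](rel (fun i => (c i - d i)%:A) _ z) => [|x].
    by apply: eq_bigr => i _; rewrite -scalerBl -linearZ.
  transitivity (\sum_i c i *: xi i x - \sum_i d i *: xi i x); last by rewrite cd subrr.
  by rewrite -sumrB; apply: eq_bigr => i _; rewrite -scalerBl -linearZ.
have [|k kE] := choice (fun z : restr Z => @reflexive _ _ _ artL.1 quotQ envI (restr X)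
    (fun f => \sum_i co f i *: phi i z) (fin_gen_restr artL.2 fgX) _).
  move=> z r f g h hE.
  transitivity (\sum_i (r * co f i + co g i) *: phi i z).
    apply: ev => x; rewrite -coP hE 2!{1}coP scaler_sumr -big_split.
    by apply: eq_bigr => i _; rewrite scalerDl scalerA.
  rewrite scaler_sumr -big_split; apply: eq_bigr => i _.
  by rewrite scalerDl scalerA.
have kxi i z : xi i (k z) = phi i z.
  rewrite -kE; transitivity (\sum_j (j == i)%:R *: phi j z).
    apply: ev => x; rewrite -coP (bigD1 i) //= eqxx scale1r big1 ?addr0 // => j /negPf ->.
    by rewrite scale0r.
  rewrite (bigD1 i) //= eqxx scale1r big1 ?addr0 // => j /negPf ->.
  by rewrite scale0r.
(* L-linearity is tested on functionals f. Both f and f (l _) are combinations of the xi i, and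
   comparing them gives a relation with coefficients in L, to which [rel] applies. *)
have kL : linear (k : Z -> X).
  move=> l z z'; apply: (functional_eq artL.1 quotQ envI (M := restr X)) => f.
  rewrite [in LHS]coP linearD [f (k z')]coP.
  have flL : linear (fun x : restr X => f (l *: (x : X))).
    by move=> r x y; rewrite scalerDr restr_scaler linearP.
  rewrite -[f (l *: k z)]/(mklin flL (k z)) [mklin flL _]coP.
  have E (d : 'I_n -> R) (w : Z) : \sum_i d i *: xi i (k w) = \sum_i d i *: phi i w.
    by apply: eq_bigr => i _; rewrite kxi.
  rewrite !E.
  have -> : \sum_i co f i *: phi i (l *: z + z') =
      \sum_i co f i *: phi i (l *: z) + \sum_i co f i *: phi i z'.
    by rewrite -big_split; apply: eq_bigr => i _; rewrite linearD scalerDr.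
  congr (_ + _).
  apply/eqP; rewrite -subr_eq0 -sumrB; apply/eqP.
  rewrite -[RHS](rel (fun i => co f i *: l - (co (mklin flL) i)%:A) _ z) => [|x].
    apply: eq_bigr => i _; rewrite scalerBl linearB restr_scalel.
    by rewrite !linearZ.
  transitivity (f (l *: x) - mklin flL x); last by rewrite subrr.
  rewrite [f _]coP [mklin flL x]coP -sumrB; apply: eq_bigr => i _.
  by rewrite scalerBl linearB restr_scalel !linearZ.
by exists (mklin kL).
Qed.

(* E is X with elements y_j adjoined subject to x'_i = \sum_j a_ji y_j, where a
   generates the relations between the generators xi of the dual of X.  If h does
   not extend to E, a functional separating (h x'_i) from the tuples
   (\sum_j a_ji z_j) has the form (z_i) |-> \sum_i xi i (k z_i) with k : Z -> X, by
   biduality; but at (h x'_i) it takes the value of the radical functional at k h,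
   which is 0. *)
Lemma left_almost_split X : fin_gen X -> indecomposable X ->
  exists (E : lmodType L) (b : {linear X -> E}), [/\ fin_gen E, is_rad b &
    forall Z (h : {linear X -> Z}), is_rad h ->
      exists g : {linear E -> Z}, h = g \o b].
Proof.
move=> fgX indX; have [N [x xX]] := fgX.
have [n [xi xiX]] := dual_fin_gen artL.1 quotQ envI (fin_gen_restr artL.2 fgX).
have [eta [eta0 eta1]] := radical_functional artL quotQ envI fgX indX xX.
have [co coP] := choice (fun k => xiX (eta k)).
(* Expanding the eta k in the generators xi i and collecting terms rewrites the radical functional
   as f |-> \sum_i xi i (f (x' i)). *)
pose x' i : X := \sum_k (co k i)%:A *: x k.
have thetaE (f : {linear X -> X}) :
    \sum_k eta k (f (x k)) = \sum_i xi i (f (x' i)).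
  under eq_bigr do rewrite coP.
  rewrite exchange_big; apply: eq_bigr => i _.
  rewrite [f _]linear_sum linear_sum; apply: eq_bigr => k _.
  by rewrite -linearZ; congr (xi i _); rewrite [RHS]linearZ.
pose rel (l : {ffun 'I_n -> (L : lmodType R)}) :=
  forall u : X, \sum_i xi i ((l i : L) *: u) = 0.
have rels : is_submodule rel.
  split.
  - by move=> u; rewrite big1 // => i _; rewrite ffunE scale0r linear0.
  - move=> l l' lE l'E u; under eq_bigr do rewrite ffunE scalerDl linearD.
    by rewrite big_split /= lE l'E addr0.
  - move=> r l lE u; under eq_bigr do rewrite ffunE restr_scalel linearZ.
    by rewrite -scaler_sumr lE scaler0.
have [m [a [arel aP]]] := ffun_submodule_generators artL rels.
have a0 j u : \sum_i xi i (a j i *: u) = 0.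
  by rewrite -[RHS](arel j u); apply: eq_bigr => i _; rewrite ffunE.
pose P : lmodType L := (X * {ffun 'I_m -> L^o})%type.
pose K (p : P) := exists c : 'I_n -> L,
  p.1 = \sum_i c i *: x' i /\ forall j, p.2 j = - \sum_i c i * a j i.
have Ks : is_submodule K.
  split.
  - exists (fun=> 0); split; first by rewrite big1 // => i _; rewrite scale0r.
    by move=> j; rewrite ffunE big1 ?oppr0 // => i _; rewrite mul0r.
  - move=> p q [c [p1 p2]] [d [q1 q2]]; exists (fun i => c i + d i); split.
      by rewrite /= p1 q1 -big_split; apply: eq_bigr => i _; rewrite scalerDl.
    move=> j; rewrite ffunE p2 q2 -opprD -big_split; congr (- _).
    by apply: eq_bigr => i _; rewrite mulrDl.
  - move=> b p [c [p1 p2]]; exists (fun i => b * c i); split.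
      by rewrite /= p1 scaler_sumr; apply: eq_bigr => i _; rewrite scalerA.
    move=> j; rewrite ffunE p2 scalerN scaler_sumr; congr (- _).
    by apply: eq_bigr => i _; rewrite -mulrA.
have [E [pi [piS piK]]] := quotient_exists Ks.
have iL : linear (fun u : X => (u, 0) : P).
  by move=> c u v; congr pair; rewrite /= scaler0 addr0.
have jL : linear (fun l : {ffun 'I_m -> L^o} => (0, l) : P).
  by move=> c u v; congr pair; rewrite /= scaler0 addr0.
pose b : {linear X -> E} := pi \o mklin iL.
pose b' : {linear {ffun 'I_m -> L^o} -> E} := pi \o mklin jL.
have bx i : b (x' i) = b' [ffun j => a j i].
  apply/eqP; rewrite -subr_eq0 -[b _]/(pi _) -[b' _]/(pi _) -linearB; apply/eqP/piK.
  exists (fun i' => (i' == i)%:R); split=> [|j].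
    rewrite /= subr0 (bigD1 i) //= eqxx scale1r big1 ?addr0 // => i' /negPf ->.
    by rewrite scale0r.
  rewrite /= sub0r !ffunE (bigD1 i) //= eqxx mul1r big1 ?addr0 // => i' /negPf ->.
  by rewrite mul0r.
exists E, b; split.
- apply: (fin_gen_surj piS); apply: fin_gen_prod => //.
  exact/fin_gen_ffun/fin_gen_regular.
- apply: is_rad_indecomposable_dom => //; first exact: fin_gen_finite_lengthL artL _ fgX.
  move=> k [w [wK Kw]]; apply: eta1.
  pose e j : {ffun 'I_m -> L^o} := [ffun j' => (j' == j)%:R].
  (* With a retraction w k of b, the x' i become \sum_j a_ji z_j inside X, and the functional would
     vanish at the identity. *)
  pose z j : X := w (k (b' (e j))).
  have xE i : x' i = \sum_j a j i *: z j.
    have -> : x' i = w (k (b (x' i))) by rewrite -[LHS]wK.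
    rewrite bx.
    have -> : [ffun j => a j i] = \sum_j a j i *: e j.
      apply/ffunP => j; rewrite !ffunE sum_ffunE (bigD1 j) //= !ffunE eqxx.
      rewrite /GRing.scale /= mulr1 big1 ?addr0 // => j' /negPf j'j.
      by rewrite !ffunE eq_sym j'j scaler0.
    by rewrite !linear_sum; apply: eq_bigr => j _; rewrite !linearZ.
  have := thetaE idfun; rewrite /= => ->.
  under eq_bigr do rewrite xE linear_sum.
  by rewrite exchange_big big1.
move=> Z h rh.
pose Tf (z : {ffun 'I_m -> restr Z}) : {ffun 'I_n -> restr Z} :=
  [ffun i => \sum_j a j i *: (z j : Z)].
have Ts : is_submodule (fun y : {ffun 'I_n -> restr Z} => exists z, y = Tf z).
  split.
  - exists 0; apply/ffunP => i; rewrite !ffunE big1 // => j _.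
    by rewrite ffunE scaler0.
  - move=> _ _ [z ->] [z' ->]; exists (z + z'); apply/ffunP => i.
    rewrite !ffunE -big_split; apply: eq_bigr => j _.
    by rewrite ffunE scalerDr.
  - move=> r _ [z ->]; exists (r *: z); apply/ffunP => i.
    rewrite !ffunE scaler_sumr; apply: eq_bigr => j _.
    by rewrite ffunE restr_scaler.
have [z zE] : exists z : 'I_m -> Z, forall i, h (x' i) = \sum_j a j i *: z j.
  apply: contrapT => nz.
  have nTh : ~ exists z, [ffun i => h (x' i) : restr Z] = Tf z.
    move=> [z zE]; apply: nz; exists z => i.
    by move/ffunP: zE => /(_ i); rewrite !ffunE.
  have [F [FT Fh]] := functional_separates artL.1 quotQ envI Ts nTh.
  have [phi FE] := ffun_functional F.
  have [|k kE] := @map_of_dual_relations X Z n xi phi fgX xiX.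
    move=> l lE z.
    have /aP[c lc] : rel [ffun i => l i].
      by move=> u; rewrite -[RHS](lE u); apply: eq_bigr => i _; rewrite ffunE.
    pose zc : {ffun 'I_m -> restr Z} := [ffun j => c j *: (z : restr Z)].
    have := FT _ (ex_intro _ zc erefl); rewrite FE => F0; rewrite -[RHS]F0.
    apply: eq_bigr => i _; congr (phi i _); have := lc i; rewrite !ffunE => ->.
    rewrite scaler_suml; apply: eq_bigr => j _.
    by rewrite ffunE restr_scaler -restr_scalel.
  apply: Fh; rewrite FE -[RHS](eta0 (k \o h)); last exact: is_rad_compl.
  by rewrite thetaE; apply: eq_bigr => i _; rewrite ffunE /= kE.
have [q qE] := free_map z.
have gL : linear (fun p : P => h p.1 + q p.2).
  by move=> c u v; rewrite !linearP scalerDr addrACA.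
have [|g gE] := factor_exists (f := mklin gL) piS.
  move=> p /piK[c [p1 p2]]; rewrite /= p1 qE linear_sum.
  under [X in _ + X]eq_bigr do rewrite p2 scaleNr.
  rewrite sumrN; apply/eqP; rewrite subr_eq0; apply/eqP.
  under [RHS]eq_bigr do rewrite scaler_suml.
  rewrite exchange_big; apply: eq_bigr => i _.
  rewrite linearZ /= zE scaler_sumr; apply: eq_bigr => j _; exact: scalerA.
exists g; apply: linear_ext => u.
transitivity (mklin gL (u, 0)); last by rewrite gE.
by rewrite /= linear0 addr0.
Qed.

End LeftAlmostSplit.

(** * Chains of radical maps between indecomposables *)

Section Chains.
Variables (A : nzRingType) (C : lmodType A -> Prop).
Hypothesis flC : forall X, C X -> finite_length X.

(** If infinitely many maps of the chain are not isomorphisms, these are radical, and its initial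
    composites reach every power of the radical. *)
Lemma rad_pow_from0_noetherian :
  (forall X, C X -> indecomposable X -> exists t, (1 <= t)%N /\ rad_pow_from0 C t X) ->
  forall (J : Type) (f : J -> arrow A), family_in_ind C f -> noetherian f.
Proof.
move=> H J f fam M g j fE comp0; apply: contrapT => nd.
have Mprop i : [/\ C (M i), indecomposable (M i) & finite_length (M i)].
  by have := fam (j i); rewrite fE /= => -[CM iM _ _]; split=> //; apply: flC.
have niso d : exists2 k, (d <= k)%N & is_rad (g k).
  apply: contrapT => nk; apply: nd; exists d => k dk; apply: contrapT => ng.
  have [_ i1 f1] := Mprop k; have [_ i2 _] := Mprop k.+1.
  by apply: nk; exists k => //; exact: is_rad_not_iso.
have lin n : exists c : {linear M 0 -> M n}, forall x, c x = comp_up g n x.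
  elim: n => [|n [c cE]]; first by exists idfun.
  by exists (g n \o c) => x /=; rewrite cE.
have radc s : exists n (c : {linear M 0 -> M n.+1}),
    rad_comp C s.+1 c /\ forall x, c x = comp_up g n.+1 x.
  elim: s => [|s [n [c [rc cE]]]].
    have [k _ rk] := niso 0%N; have [c cE] := lin k.
    exists k, (g k \o c); split; first exact: is_rad_compr.
    by move=> x /=; rewrite cE.
  have [k nk rk] := niso n.+1.
  have [c' [rc' c'E]] : exists c' : {linear M 0 -> M k},
      rad_comp C s.+1 c' /\ forall x, c' x = comp_up g k x.
    elim: k nk {rk} => // k IHk; rewrite leq_eqVlt => /orP[/eqP[<-]|/IHk].
      by exists c.
    move=> [c' [rc' c'E]]; exists (g k \o c'); split.
      exact: rad_comp_postcomp.
    by move=> x /=; rewrite c'E.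
  exists k, (g k \o c'); split; last by move=> x /=; rewrite c'E.
  by apply: rad_comp_rcons => //; have [] := Mprop k.
have [C0 i0 _] := Mprop 0%N.
have [t [t0 tP]] := H _ C0 i0.
have [n [c [rc cE]]] := radc t.-1.
apply: (comp0 n) => x; rewrite -cE; move: x; apply: tP.
  by have [] := Mprop n.+1.
by apply: rad_comp_pow; rewrite prednK in rc.
Qed.

Lemma rad_pow_to0_conoetherian :
  (forall X, C X -> indecomposable X -> exists t, (1 <= t)%N /\ rad_pow_to0 C t X) ->
  forall (J : Type) (f : J -> arrow A), family_in_ind C f -> conoetherian f.
Proof.
move=> H J f fam M g j fE comp0; apply: contrapT => nd.
have Mprop i : [/\ C (M i), indecomposable (M i) & finite_length (M i)].
  by have := fam (j i); rewrite fE /= => -[_ _ CM iM]; split=> //; apply: flC.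
have niso d : exists2 k, (d <= k)%N & is_rad (g k).
  apply: contrapT => nk; apply: nd; exists d => k dk; apply: contrapT => ng.
  have [_ i1 _] := Mprop k; have [_ i2 f2] := Mprop k.+1.
  by apply: nk; exists k => //; exact: is_rad_not_iso.
have lin n : exists c : {linear M n -> M 0}, forall x, c x = comp_down g (n:=n) x.
  elim: n => [|n [c cE]]; first by exists idfun.
  by exists (c \o g n) => x /=; rewrite cE.
have radc s : exists n (c : {linear M n.+1 -> M 0}),
    rad_comp C s.+1 c /\ forall x, c x = comp_down g (n:=n.+1) x.
  elim: s => [|s [n [c [rc cE]]]].
    have [k _ rk] := niso 0%N; have [c cE] := lin k.
    exists k, (c \o g k); split; first exact: is_rad_compl.
    by move=> x /=; rewrite cE.
  have [k nk rk] := niso n.+1.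
  have [c' [rc' c'E]] : exists c' : {linear M k -> M 0},
      rad_comp C s.+1 c' /\ forall x, c' x = comp_down g (n:=k) x.
    elim: k nk {rk} => // k IHk; rewrite leq_eqVlt => /orP[/eqP[<-]|/IHk].
      by exists c.
    move=> [c' [rc' c'E]]; exists (c' \o g k); split.
      exact: rad_comp_precomp.
    by move=> x /=; rewrite c'E.
  exists k, (c' \o g k); split; last by move=> x /=; rewrite c'E.
  by apply: rad_comp_cons => //; have [] := Mprop k.
have [C0 i0 _] := Mprop 0%N.
have [t [t0 tP]] := H _ C0 i0.
have [n [c [rc cE]]] := radc t.-1.
apply: (comp0 n) => x; rewrite -cE; move: x; apply: tP.
  by have [] := Mprop n.+1.
by apply: rad_comp_pow; rewrite prednK in rc.
Qed.

(** The list covers P but its members may lie outside P, which makes the notion pass to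
    subclasses. *)
Definition finitely_many (P : lmodType A -> Prop) :=
  exists n (M : 'I_n -> lmodType A), (forall k, C (M k) /\ indecomposable (M k)) /\
    forall X, P X -> exists k, isomorphic X (M k).

Lemma finitely_many_finType (T : finType) (M : T -> lmodType A) (P : lmodType A -> Prop) :
  (forall t, C (M t) /\ indecomposable (M t)) ->
  (forall X, P X -> exists t, isomorphic X (M t)) -> finitely_many P.
Proof.
move=> MC PM; exists #|T|, (M \o enum_val); split=> [k|X /PM[t Xt]]; first exact: MC.
by exists (enum_rank t); rewrite /= enum_rankK.
Qed.

Lemma finitely_many_bigcup (T : finType) (P : T -> lmodType A -> Prop) :
  (forall t, finitely_many (P t)) -> finitely_many (fun X => exists t, P t X).
Proof.
move=> H; pose n t := projT1 (cid (H t)); pose M t := projT1 (cid (projT2 (cid (H t)))).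
have MP t : (forall k, C (M t k) /\ indecomposable (M t k)) /\
    forall X, P t X -> exists k, isomorphic X (M t k) := projT2 (cid (projT2 (cid (H t)))).
apply: (@finitely_many_finType {t & 'I_(n t)} (fun tk => M (tag tk) (tagged tk))).
  by move=> [t k]; apply: (MP t).1.
by move=> X [t /(MP t).2[k Xk]]; exists (Tagged (fun t => 'I_(n t)) k).
Qed.

Lemma finitely_many_sub (P P' : lmodType A -> Prop) :
  (forall X, P X -> P' X) -> finitely_many P' -> finitely_many P.
Proof.
by move=> PP' [n [M [MC MP]]]; exists n, M; split=> // X /PP'/MP.
Qed.

Lemma finitely_many1 X : C X -> indecomposable X -> finitely_many (isomorphic X).
Proof.
move=> CX iX; exists 1%N, (fun=> X); split=> // Y XY; exists ord0.
exact: isomorphic_sym.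
Qed.

Lemma finitely_many_or (P P' : lmodType A -> Prop) :
  finitely_many P -> finitely_many P' -> finitely_many (fun X => P X \/ P' X).
Proof.
move=> fP fP'; apply: (finitely_many_sub (P' := fun X => exists b : bool, (if b then P else P') X)).
  by move=> X [?|?]; [exists true|exists false].
by apply: finitely_many_bigcup => -[].
Qed.

Hypothesis isoC : iso_closed C.
Hypothesis sumC : summand_closed C.

(** * The branching argument for noetherian families *)

Section Konig.

Hypothesis left_almost : forall X, C X -> indecomposable X ->
  exists (Y : lmodType A) (b : {linear X -> Y}), [/\ C Y, is_rad b &
    forall Z : lmodType A, C Z -> forall h : {linear X -> Z}, is_rad h ->
      exists g : {linear Y -> Z}, h = g \o b].

(** x stands for the path followed so far, being the image of the generating element along it. *)
Definition reaches (X : lmodType A) (x : X) (Z : lmodType A) :=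
  [/\ C Z, indecomposable Z & exists h : {linear X -> Z}, h x <> 0].

(** A map h that is not an isomorphism factors through b, and a nonzero h x survives on some summand
    of Y. So x reaches at most the class of X and what the finitely many components of b x reach,
    and one of these reaches infinitely many classes. *)
Lemma infinite_reach_step (X : lmodType A) (x : X) : C X -> indecomposable X ->
  ~ finitely_many (reaches x) ->
  exists (Z : lmodType A) (r : {linear X -> Z}), [/\ C Z, indecomposable Z, is_rad r &
    ~ finitely_many (reaches (r x))].
Proof.
move=> CX iX inf; apply: contrapT => H; apply: inf.
have [Y [b [CY rb bP]]] := left_almost CX iX.
have [n [S [SP SE]]] := decomposition flC isoC sumC CY.
apply: (finitely_many_sub (P' := fun Z => isomorphic X Z \/
    exists k, reaches (proj (S k) (b x)) Z)); last first.
  apply: finitely_many_or; first exact: finitely_many1.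
  apply: finitely_many_bigcup => k; apply: contrapT => nf; apply: H.
  have [Ck ik] := SP k.
  exists (part (S k)), (proj (S k) \o b); split=> //; exact: is_rad_compl.
move=> Z [CZ iZ [h hx]].
have [hiso|nhiso] := pselect (is_iso h); first by left; exists h.
right; have rh : is_rad h by apply: is_rad_not_iso => //; exact: flC.
have [g hE] := bP _ CZ h rh.
apply: contrapT => nk; apply: hx.
rewrite hE /= (SE (b x)) linear_sum big1 // => k _.
apply: contrapT => gk; apply: nk; exists k; split=> //.
by exists (g \o incl (S k)).
Qed.

Lemma noetherian_reaches :
  (forall (J : Type) (f : J -> arrow A), family_in_ind C f -> noetherian f) ->
  forall (X : lmodType A) (x : X), C X -> indecomposable X -> finitely_many (reaches x).
Proof.
move=> noeth X x CX iX; apply: contrapT => inf.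
pose T := {p : {X : lmodType A & X} |
  [/\ C (tag p), indecomposable (tag p) & ~ finitely_many (reaches (tagged p))]}.
have step (s : T) : exists s' : T, exists r : {linear tag (sval s) -> tag (sval s')},
    is_rad r /\ r (tagged (sval s)) = tagged (sval s').
  case: s => -[Y y] [/= CY iY ninf].
  have [Z [r [CZ iZ rr rinf]]] := infinite_reach_step CY iY ninf.
  by exists (exist _ (existT (fun X : lmodType A => X : Type) Z (r y))
    (And3 CZ iZ rinf)); exists r.
have [next nextP] := choice step.
pose s0 : T := exist _ (existT (fun X : lmodType A => X : Type) X x) (And3 CX iX inf).
pose st n := iter n next s0.
pose M n := tag (sval (st n)).
pose g n : {linear M n -> M n.+1} := projT1 (cid (nextP (st n))).
have gP n : is_rad (g n) /\ g n (tagged (sval (st n))) = tagged (sval (st n.+1)) :=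
  projT2 (cid (nextP (st n))).
have MP n : [/\ C (M n), indecomposable (M n) &
    ~ finitely_many (reaches (tagged (sval (st n))))] by rewrite /M; case: (st n).
have [|||d dP] := noeth nat (fun n => Arrow (g n)) _ M g id.
- by move=> n /=; have [? ? _] := MP n; have [? ? _] := MP n.+1.
- by [].
(* Were the composite zero, the current element would be 0, which reaches nothing. *)
- move=> n c0; have [_ _] := MP n.+1; apply.
  have cE : forall k, comp_up g k x = tagged (sval (st k)).
    by elim=> // k IHk; rewrite /= IHk (gP k).2.
  apply: (finitely_many_sub (P' := fun Z => exists t : void, False)).
    by move=> Z [_ _ [h]]; rewrite -cE c0 linear0.
  by apply: finitely_many_bigcup => -[].
have [_ [nz _] _] := MP d.
exact: is_rad_nonsplit_iso nz (gP d).1 (dP d (leqnn d)).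
Qed.

(** Y may be decomposable, so the search starts from each component of c. *)
Lemma noetherian_finite_rep_type (Y : lmodType A) (c : Y) : C Y ->
  (forall Z : lmodType A, C Z -> forall z : Z, exists h : {linear Y -> Z}, h c = z) ->
  (forall (J : Type) (f : J -> arrow A), family_in_ind C f -> noetherian f) ->
  finite_rep_type C.
Proof.
move=> CY cP noeth.
have [n [S [SP SE]]] := decomposition flC isoC sumC CY.
have fm : finitely_many (fun Z => exists k, reaches (proj (S k) c) Z).
  by apply: finitely_many_bigcup => k; have [? ?] := SP k; exact: noetherian_reaches.
have [m [M [MC MP]]] := fm.
exists m, M; split=> // X CX iX; apply: MP; apply: contrapT => nk.
case: (iX) => nX _; apply: nX => x.
have [h <-] := cP X CX x.
rewrite (SE c) linear_sum big1 // => k _.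
apply: contrapT => hk; apply: nk; exists k; split=> //.
by exists (h \o incl (S k)).
Qed.

End Konig.

(** * The branching argument for conoetherian families *)

Section DualKonig.
Variable D : lmodType A.

Hypothesis right_almost : forall X, C X -> indecomposable X ->
  exists (Y : lmodType A) (b : {linear Y -> X}), [/\ C Y, is_rad b &
    forall Z : lmodType A, C Z -> forall h : {linear Z -> X}, is_rad h ->
      exists g : {linear Z -> Y}, h = b \o g].

(** A path now ends at a fixed module D and is recorded by its composite xi; nonvanishing is tested
    after xi. *)
Definition coreaches (X : lmodType A) (xi : {linear X -> D}) (Z : lmodType A) :=
  [/\ C Z, indecomposable Z & exists h : {linear Z -> X}, exists z, xi (h z) <> 0].

Lemma infinite_coreach_step (X : lmodType A) (xi : {linear X -> D}) : C X -> indecomposable X ->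
  ~ finitely_many (coreaches xi) ->
  exists (Z : lmodType A) (r : {linear Z -> X}), [/\ C Z, indecomposable Z, is_rad r &
    ~ finitely_many (coreaches (xi \o r))].
Proof.
move=> CX iX inf; apply: contrapT => H; apply: inf.
have [Y [b [CY rb bP]]] := right_almost CX iX.
have [n [S [SP SE]]] := decomposition flC isoC sumC CY.
apply: (finitely_many_sub (P' := fun Z => isomorphic X Z \/
    exists k, coreaches (xi \o (b \o incl (S k))) Z)); last first.
  apply: finitely_many_or; first exact: finitely_many1.
  apply: finitely_many_bigcup => k; apply: contrapT => nf; apply: H.
  have [Ck ik] := SP k.
  exists (part (S k)), (b \o incl (S k)); split=> //; exact: is_rad_compr.
move=> Z [CZ iZ [h [z hz]]].
have [hiso|nhiso] := pselect (is_iso h).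
  by left; apply: isomorphic_sym; exists h.
right; have rh : is_rad h by apply: is_rad_not_iso => //; exact: flC.
have [g hE] := bP _ CZ h rh.
apply: contrapT => nk; apply: hz.
rewrite hE /= (SE (g z)) !linear_sum big1 // => k _.
apply: contrapT => gk; apply: nk; exists k; split=> //.
by exists (proj (S k) \o g), z.
Qed.

Lemma conoetherian_coreaches :
  (forall (J : Type) (f : J -> arrow A), family_in_ind C f -> conoetherian f) ->
  forall (X : lmodType A) (xi : {linear X -> D}), C X -> indecomposable X ->
    finitely_many (coreaches xi).
Proof.
move=> noeth X xi CX iX; apply: contrapT => inf.
pose T := {p : {X : lmodType A & {linear X -> D}} |
  [/\ C (tag p), indecomposable (tag p) & ~ finitely_many (coreaches (tagged p))]}.
have step (s : T) : exists s' : T, exists r : {linear tag (sval s') -> tag (sval s)},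
    is_rad r /\ tagged (sval s) \o r = tagged (sval s') :> (_ -> _).
  case: s => -[Y y] [/= CY iY ninf].
  have [Z [r [CZ iZ rr rinf]]] := infinite_coreach_step CY iY ninf.
  by exists (exist _ (existT (fun X : lmodType A => {linear X -> D}) Z (y \o r))
    (And3 CZ iZ rinf)); exists r.
have [next nextP] := choice step.
pose s0 : T := exist _ (existT (fun X : lmodType A => {linear X -> D}) X xi)
  (And3 CX iX inf).
pose st n := iter n next s0.
pose M n := tag (sval (st n)).
pose g n : {linear M n.+1 -> M n} := projT1 (cid (nextP (st n))).
have gP n : is_rad (g n) /\
    tagged (sval (st n)) \o g n = tagged (sval (st n.+1)) :> (_ -> _) :=
  projT2 (cid (nextP (st n))).
have MP n : [/\ C (M n), indecomposable (M n) &
    ~ finitely_many (coreaches (tagged (sval (st n))))] by rewrite /M; case: (st n).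
have [|||d dP] := noeth nat (fun n => Arrow (g n)) _ M g id.
- by move=> n /=; have [? ? _] := MP n; have [? ? _] := MP n.+1.
- by [].
- move=> n c0; have [_ _] := MP n.+1; apply.
  have cE : forall k (m : M k), xi (comp_down g (n:=k) m) = tagged (sval (st k)) m.
    elim=> // k IHk m; rewrite /= IHk.
    by have := congr1 (fun u => u m) (gP k).2.
  apply: (finitely_many_sub (P' := fun Z => exists t : void, False)).
    by move=> Z [_ _ [h [z]]]; rewrite -cE c0 linear0.
  by apply: finitely_many_bigcup => -[].
have [_ [nz _] _] := MP d.+1.
exact: is_rad_nonsplit_iso nz (gP d).1 (dP d (leqnn d)).
Qed.

Lemma conoetherian_finite_rep_type (Y : lmodType A) (xi : {linear Y -> D}) : C Y ->
  (forall Z : lmodType A, C Z -> forall z : Z, z <> 0 ->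
    exists h : {linear Z -> Y}, xi (h z) <> 0) ->
  (forall (J : Type) (f : J -> arrow A), family_in_ind C f -> conoetherian f) ->
  finite_rep_type C.
Proof.
move=> CY xiP noeth.
have [n [S [SP SE]]] := decomposition flC isoC sumC CY.
have fm : finitely_many (fun Z => exists k, coreaches (xi \o incl (S k)) Z).
  by apply: finitely_many_bigcup => k; have [? ?] := SP k; exact: conoetherian_coreaches.
have [m [M [MC MP]]] := fm.
exists m, M; split=> // X CX iX; apply: MP; apply: contrapT => nk.
case: (iX) => nX _; apply: nX => x; apply: contrapT => x0.
have [h] := xiP X CX x x0; apply.
rewrite (SE (h x)) linear_sum big1 // => k _.
apply: contrapT => hk; apply: nk; exists k; split=> //.
by exists (proj (S k) \o h), x.
Qed.

End DualKonig.

End Chains.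

(** * Finite type and nilpotency of the radical *)

Section Nakayama.
Variables (A : nzRingType) (K : Type) (M : K -> lmodType A).
Definition map_class := forall X Y : lmodType A, {linear X -> Y} -> Prop.

Implicit Types (W : lmodType A) (G : seq {k : K & M k}) (P : map_class).

(* [gen P G w]: w is a sum of images of the elements listed in G under maps
   satisfying P. *)
Fixpoint gen (P : map_class) G (W : lmodType A) (w : W) : Prop :=
  if G is g :: G' then
    exists r : {linear M (tag g) -> W}, P _ _ r /\ gen P G' (w - r (tagged g))
  else w = 0.

Definition any_map : map_class := fun X Y r => True.

Lemma gen_add P G W (w w' : W) :
  (forall (X Y : lmodType A) (r r' : {linear X -> Y}), P X Y r -> P X Y r' -> P X Y (r \+ r')) ->
  gen P G w -> gen P G w' -> gen P G (w + w').
Proof.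
move=> PD; elim: G w w' => [|g G IHG] w w' /=; first by move=> -> ->; rewrite addr0.
move=> [r [Pr wr]] [r' [Pr' wr']]; exists (r \+ r'); split; first exact: PD.
by rewrite /= opprD addrACA; exact: IHG.
Qed.

Lemma gen_map P P' G W W' (f : {linear W -> W'}) w :
  (forall (X : lmodType A) (r : {linear X -> W}), P X W r -> P' X W' (f \o r)) ->
  gen P G w -> gen P' G (f w).
Proof.
move=> PP'; elim: G w => [|g G IHG] w /=; first by move=> ->; rewrite linear0.
move=> [r [Pr wr]]; exists (f \o r); split; first exact: PP'.
by rewrite /= -linearB; exact: IHG.
Qed.

Lemma gen0 P G W : (forall X, P X W \0) -> gen P G (0 : W).
Proof. by move=> P0; elim: G => //= g G IHG; exists \0; rewrite subr0. Qed.

Lemma gen_sum P G (W : lmodType A) (I : Type) (s : seq I) (F : I -> W) :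
  (forall X, P X W \0) ->
  (forall (X Y : lmodType A) (r r' : {linear X -> Y}), P X Y r -> P X Y r' -> P X Y (r \+ r')) ->
  (forall i, gen P G (F i)) -> gen P G (\sum_(i <- s) F i).
Proof.
move=> P0 PD GF; elim: s => [|i s IHs]; first by rewrite big_nil; exact: gen0.
by rewrite big_cons; exact: gen_add.
Qed.

Lemma gen_cat P G G' W (w : W) : (forall X, P X W \0) ->
  gen P G w \/ gen P G' w -> gen P (G ++ G') w.
Proof.
move=> P0; elim: G w => [|g G IHG] w /=.
  by case=> // ->; exact: gen0.
case=> [[r [Pr wr]]|Gw].
  by exists r; split=> //; apply: IHG; left.
by exists \0; split=> //; apply: IHG; right; rewrite subr0.
Qed.

Variable U : forall k, M k -> Prop.
Arguments U : clear implicits.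

Fixpoint all_in (G : seq {k : K & M k}) : Prop :=
  if G is g :: G' then U (tag g) (tagged g) /\ all_in G' else True.

Lemma all_in_cat G G' : all_in G -> all_in G' -> all_in (G ++ G').
Proof. by elim: G => //= g G IHG [Ug aG] aG'; split=> //; exact: IHG. Qed.

(** Generators are discarded one at a time: u0 is r0 u0 plus terms from the others, with r0 radical,
    and 1 - r0 is invertible. The first hypothesis is quantified over lists because it is reapplied
    to each shorter one. *)
Lemma nakayama G :
  (forall G, (forall k m, U k m -> gen any_map G m) ->
    forall k m, U k m -> gen (@is_rad A) G m) ->
  all_in G -> (forall k m, U k m -> gen any_map G m) ->
  forall k m, U k m -> m = 0.
Proof.
move=> radU; elim: G => [_ H k m /H//|[k0 u0] G IHG /= [Uu0 aG] H].
apply: IHG => // k m Um.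
have [r0 [rr0 u0E]] := radU (existT (fun k => M k : Type) k0 u0 :: G) H _ _ Uu0.
have u0G : gen any_map G u0.
  have [w [wK _]] := rr0 idfun.
  by rewrite -(wK u0); apply: (gen_map (P := @is_rad A)); last exact: u0E.
have [r [_ mE]] := H _ _ Um.
rewrite -(subrK (r u0) m); apply: gen_add => //.
by apply: (gen_map (P := any_map)); last exact: u0G.
Qed.

End Nakayama.

(** * The implications for the subcategory C *)

Section Main.
Variables (R : comNzRingType) (L : algType R) (Q I : lmodType R).
Variable C : lmodType L -> Prop.
Hypothesis artL : artin_algebra L.
Hypothesis quotQ : quotient_by (@jacobson_radical R) Q.
Hypothesis envI : injective_envelope Q I.
Hypothesis fgC : forall X : lmodType L, C X -> fin_gen X.
Hypothesis isoC : iso_closed C.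
Hypothesis sumC : summand_closed C.
Hypothesis ffC : functorially_finite C.

Let flC (X : lmodType L) : C X -> finite_length X.
Proof. by move=> /fgC; exact: (fin_gen_finite_lengthL artL). Qed.

(** When e generates X, this realizes the radical powers of Hom(X, Y) inside the R-module Y^n. *)
Lemma rad_pow_value_submodule (X Y : lmodType L) i n (e : 'I_n -> X) :
  is_submodule (fun y : {ffun 'I_n -> restr Y} =>
    exists2 f : {linear X -> Y}, rad_pow C i f & forall j, y j = f (e j)).
Proof.
split.
- by exists \0 => [|j]; [exact: rad_pow0|rewrite ffunE].
- move=> y z [f rf yE] [g rg zE]; exists (f \+ g); first exact: rad_pow_add.
  by move=> j; rewrite ffunE yE zE.
- move=> r y [f rf yE]; have [s sE] := scale_map Y r.
  exists (s \o f); first exact: rad_pow_postcomp.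
  by move=> j; rewrite ffunE yE /= sE.
Qed.

Lemma rad_pow_element_submodule (X Y : lmodType L) i (x : X) :
  is_submodule (fun y : restr Y => exists2 f : {linear X -> Y}, rad_pow C i f & y = f x).
Proof.
split.
- by exists \0 => //; exact: rad_pow0.
- by move=> _ _ [f rf ->] [g rg ->]; exists (f \+ g) => //; exact: rad_pow_add.
- move=> r _ [f rf ->]; have [s sE] := scale_map Y r.
  by exists (s \o f); [exact: rad_pow_postcomp|rewrite /= sE].
Qed.

Lemma finite_rep_type_rad_infty : finite_rep_type C -> rad_infty_eq0 C.
Proof.
move=> [n [M [MC MP]]] X Y CX CY h rh x.
(* The index is shifted because powers of the radical start at 1. *)
pose V i k (y : restr (M k)) := exists2 f : {linear X -> M k}, rad_pow C i.+1 f & y = f x.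
have Vs i k : is_submodule (V i k) by exact: rad_pow_element_submodule.
have flM k : finite_length (restr (M k) : lmodType R).
  exact/(fin_gen_restr_finite_length artL)/fgC/(MC k).1.
have /choice[d dP] : forall k, exists d, forall i y, (d <= i)%N -> V d k y -> V i k y.
  move=> k; apply: (finite_length_dcc (flM k)) => [i|i y [f rf yE]]; first exact: Vs.
  by exists f => //; exact: rad_powW.
pose N := \max_k d k.
have NV k y : V N k y -> V N.+1 k y.
  have Vle i j : (i <= j)%N -> V j k y -> V i k y.
    move=> /subnK <-; elim: (j - i)%N => // m IHm [f rf yE]; apply: IHm.
    by exists f => //; exact: rad_powW.
  move=> /(Vle (d k)) H; apply: (dP k); first by rewrite ltnW // ltnS leq_bigmax.
  by apply: H; exact: leq_bigmax.
pose U k (m : M k) := V N k m.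
(* Objects of C are sums of copies of the M k, so the values at x of the maps
   in the radical power N.+1 to any object are generated by the V N k. *)
have genC G : (forall k m, U k m -> gen (@any_map L) G m) ->
    forall (Z : lmodType L) (f : {linear X -> Z}), C Z -> rad_pow C N.+1 f ->
    gen (@any_map L) G (f x).
  move=> H Z f CZ rf.
  have [p [S [SP SE]]] := decomposition flC isoC sumC CZ.
  rewrite (SE (f x)); apply: gen_sum => // l.
  have [CS iS] := SP l; have [k [phi [psi [phiK psiK]]]] := MP _ CS iS.
  apply: (@gen_map _ _ _ (@any_map L)) => //.
  rewrite -[proj _ _]phiK; apply: (@gen_map _ _ _ (@any_map L)) => //.
  apply: H; exists (phi \o (proj (S l) \o f)) => //.
  by do 2!apply: rad_pow_postcomp.
have U0 : forall k m, U k m -> m = 0.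
  pose s k := projT1 (cid (finite_length_fin_gen (flM k) (Vs N k))).
  have sE k y : V N k y <-> span_over (fun y => y = 0) (s k) y.
    exact: projT2 (cid (finite_length_fin_gen (flM k) (Vs N k))) y.
  pose tg k (u : restr (M k)) := existT (fun k => M k : Type) k u.
  pose G := flatten [seq [seq tg k u | u <- s k] | k <- enum 'I_n].
  apply: (@nakayama _ _ M U G).
  (* By stability m is a value of a map in the power N+2; splitting off its last radical factors
     leaves values of maps in the power N+1, which G generates. *)
  - move=> {}G H k m /NV[f rf ->].
    have [p [Z [f1 [g [fgP ->]]]]] := rad_powS (ltn0Sn N) rf.
    apply: gen_sum => [Z'|Z' W r r'|l]; [exact: is_rad0|exact: is_rad_add|].
    have [CZ rf1 rg] := fgP l.
    apply: (@gen_map _ _ _ (@any_map L)); last exact: genC.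
    by move=> W r _; exact: is_rad_compr.
  - rewrite /G; elim: (enum 'I_n) => //= k ks IH; apply: all_in_cat => //.
    have : forall u, u \in s k -> U k u.
      by move=> u us; apply/sE/span_over_mem => //; exact: is_submodule0.
    elim: (s k) => //= u t IHt H; split; first by apply: H; rewrite mem_head.
    by apply: IHt => v vt; apply: H; rewrite inE vt orbT.
  - move=> k m /sE ms.
    have : k \in enum 'I_n by rewrite mem_enum.
    rewrite /G; elim: (enum 'I_n) => //= k' ks IH; rewrite inE => /orP[/eqP kE|/IH H].
      apply: gen_cat => //; left; rewrite -{k'}kE.
      elim: (s k) m ms {IH} => //= u t IHt m [c /IHt H].
      have [r rE] := scale_map (M k) c.
      by exists r; split=> //=; rewrite rE.
    by apply: gen_cat => //; right.
(* As all the U k vanish, the empty list generates them, and generation by it means h x = 0. *)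
have : gen (@any_map L) (M := M) [::] (h x).
  apply: genC => //; last exact: rh.
by [].
Qed.

Lemma left_approx_element : exists (Y : lmodType L) (c : Y), C Y /\
  forall Z : lmodType L, C Z -> forall z : Z, exists h : {linear Y -> Z}, h c = z.
Proof.
have [[Y [f [CY fP]]] _] := ffC (fin_gen_regular L).
exists Y, (f 1); split=> // Z CZ z.
have gL : linear (fun l : L^o => (l : L) *: z).
  by move=> a l l'; rewrite scalerDl scalerA.
have [h hE] := fP Z CZ (mklin gL); exists h.
by rewrite -[LHS]hE /= scale1r.
Qed.

(** An R-functional nonzero at z gives a map Z -> D(L) whose value at z is nonzero at 1; it factors
    through the approximation. *)
Lemma right_approx_functional : exists (Y : lmodType L)
    (xi : {linear Y -> artin_dual L I}), C Y /\
  forall Z : lmodType L, C Z -> forall z : Z, z <> 0 ->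
    exists h : {linear Z -> Y}, xi (h z) <> 0.
Proof.
have [_ [Y [f [CY fP]]]] := ffC (fin_gen_artin_dual artL quotQ envI).
exists Y, f; split=> // Z CZ z z0.
have [F [_ Fz]] := functional_separates artL.1 quotQ envI (is_submodule0 (restr Z)) z0.
have [g gE] := functional_to_dual F.
have [h hE] := fP Z CZ g; exists h => fhz; apply: Fz.
have := gE z 1; rewrite scale1r => <-.
by rewrite hE /= fhz.
Qed.

Lemma rad_infty_nilpotent : rad_infty_eq0 C ->
  exists t, (1 <= t)%N /\ forall X Y : lmodType L, C X -> C Y -> forall h : {linear X -> Y},
    rad_pow C t h -> h =1 \0.
Proof.
move=> rad0.
have [X0 [c [CX0 cP]]] := left_approx_element.
have [Y0 [xi [CY0 xiP]]] := right_approx_functional.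
have [n [e eX]] := fgC CX0.
pose V i (y : {ffun 'I_n -> restr Y0}) :=
  exists2 f : {linear X0 -> Y0}, rad_pow C i.+1 f & forall j, y j = f (e j).
have [|||d dP] := @finite_length_dcc R {ffun 'I_n -> restr Y0} V.
- apply: (fin_gen_finite_length artL.1); apply: fin_gen_ffun.
  exact/(fin_gen_restr artL.2)/fgC.
- by move=> i; exact: rad_pow_value_submodule.
- by move=> i y [f rf yE]; exists f => //; exact: rad_powW.
(* The chain is constant from d on and a map is determined by its values at e, so the power d+1 from
   X0 to Y0 lies in every power. *)
have X0Y0 (f : {linear X0 -> Y0}) : rad_pow C d.+1 f -> f =1 \0.
  move=> rf; apply: rad0 => // -[//|i] _.
  have [di|] := leqP d i.
    have [|f' rf' fE] := dP i [ffun j => f (e j)] di.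
      by exists f => // j; rewrite ffunE.
    have -> // : f = f'.
    apply: linear_ext => x; have [a ->] := eX x; rewrite !linear_sum.
    by apply: eq_bigr => j _; rewrite !linearZ -fE ffunE.
  move=> /ltnW/subnK; move: (d - i)%N => m; elim: m i => [|m IHm] i; first by rewrite add0n => ->.
  by rewrite addSnnS => /IHm; exact: rad_powW.
exists d.+1; split=> // X Y CX CY h rh x; apply: contrapT => hx.
have [p px] := cP X CX x.
have [q qx] := xiP Y CY (h x) hx.
have := X0Y0 (q \o (h \o p)) (rad_pow_postcomp _ (rad_pow_precomp _ rh)) c.
by rewrite /= px => qhx; apply: qx; rewrite qhx linear0.
Qed.

Lemma left_almost_split_in (X : lmodType L) : C X -> indecomposable X ->
  exists (Y : lmodType L) (b : {linear X -> Y}), [/\ C Y, is_rad b &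
    forall Z : lmodType L, C Z -> forall h : {linear X -> Z}, is_rad h ->
      exists g : {linear Y -> Z}, h = g \o b].
Proof.
move=> CX iX; have [E [b [fgE rb bP]]] := left_almost_split artL quotQ envI (fgC CX) iX.
have [[Y [f [CY fP]]] _] := ffC fgE.
exists Y, (f \o b); split=> //; first exact: is_rad_compl.
move=> Z CZ h /bP[g ->]; have [g' gE] := fP Z CZ g.
by exists g'; apply: linear_ext => x; exact: gE.
Qed.

Lemma right_almost_split_in (X : lmodType L) : C X -> indecomposable X ->
  exists (Y : lmodType L) (b : {linear Y -> X}), [/\ C Y, is_rad b &
    forall Z : lmodType L, C Z -> forall h : {linear Z -> X}, is_rad h ->
      exists g : {linear Z -> Y}, h = b \o g].
Proof.
move=> CX iX; have [E [b [fgE rb bP]]] := right_almost_split artL quotQ envI (fgC CX) iX.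
have [_ [Y [f [CY fP]]]] := ffC fgE.
exists Y, (b \o f); split=> //; first exact: is_rad_compr.
move=> Z CZ h /bP[g ->]; have [g' gE] := fP Z CZ g.
by exists g'; apply: linear_ext => x; rewrite /= gE.
Qed.

End Main.

Theorem theorem3p15
  (R : comNzRingType) (L : algType R) (Q I : lmodType R)
  (C : lmodType L -> Prop)
  (artL : artin_algebra L)
  (quotQ : quotient_by (@jacobson_radical R) Q)
  (envI : injective_envelope Q I)
  (fgC : forall X : lmodType L, C X -> fin_gen X)
  (addC : additive_subcat C)
  (isoC : iso_closed C)
  (sumC : summand_closed C)
  (ffC : functorially_finite C) :
  (C (artin_dual L I) ->
   [<-> exists t : nat, (1 <= t)%N /\
          forall X : lmodType L, C X -> indecomposable X ->
            rad_pow_from0 C t X;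
        forall X : lmodType L, C X -> indecomposable X ->
          exists t : nat, (1 <= t)%N /\ rad_pow_from0 C t X;
        forall (J : Type) (f : J -> arrow L),
          family_in_ind C f -> noetherian f;
        finite_rep_type C;
        rad_infty_eq0 C]) /\
  (C L^o ->
   [<-> exists t : nat, (1 <= t)%N /\
          forall X : lmodType L, C X -> indecomposable X ->
            rad_pow_to0 C t X;
        forall X : lmodType L, C X -> indecomposable X ->
          exists t : nat, (1 <= t)%N /\ rad_pow_to0 C t X;
        forall (J : Type) (f : J -> arrow L),
          family_in_ind C f -> conoetherian f;
        finite_rep_type C;
        rad_infty_eq0 C]).
Proof.
have flC X : C X -> finite_length X.
  by move=> /fgC; exact: (fin_gen_finite_lengthL artL).
split=> _; tfae.
- by move=> [t [t0 tP]] X CX iX; exists t; split=> //; apply: tP.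
- exact: rad_pow_from0_noetherian.
- have [Y [c [CY cP]]] := left_approx_element ffC.
  apply: (noetherian_finite_rep_type flC isoC sumC _ CY cP).
  exact: (left_almost_split_in artL quotQ envI fgC ffC).
- exact: (finite_rep_type_rad_infty artL fgC isoC sumC).
- move=> /(rad_infty_nilpotent artL quotQ envI fgC ffC)[t [t0 tP]].
  by exists t; split=> // X CX _ Y CY; apply: tP.
- by move=> [t [t0 tP]] X CX iX; exists t; split=> //; apply: tP.
- exact: rad_pow_to0_conoetherian.
- have [Y [xi [CY xiP]]] := right_approx_functional artL quotQ envI ffC.
  apply: (conoetherian_finite_rep_type flC isoC sumC _ CY xiP).
  exact: (right_almost_split_in artL quotQ envI fgC ffC).
- exact: (finite_rep_type_rad_infty artL fgC isoC sumC).
- move=> /(rad_infty_nilpotent artL quotQ envI fgC ffC)[t [t0 tP]].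
  by exists t; split=> // X CX _ Y CY; apply: tP.
Qed.
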